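(* Let $(a_1,a_3)\in\{(1,1),(1,-1),(-1,-1)\}$. Let $(\omega_0,\gamma_0)\in\Gamma_{\mathrm{no}}$ and let $t>0$ be such that $\omega_0=a_1\frac t3-a_3\frac15t^3$ and $\gamma_0=a_1\frac{2}{3t}+a_3\frac65t$. In the case $a_1=a_3=1$ assume in addition that $(\omega_0,\gamma_0)\ne\left(\frac{2\sqrt5}{27},\frac{4\sqrt5}{5}\right)$. Then $J(\omega_0,\gamma_0)$ is undefined (no standing wave profile exists at $(\omega_0,\gamma_0)$), and $$\lim_{\omega\to\omega_0-,\ \gamma\to\gamma_0-}J(\omega,\gamma)=+\infty .$$ If $a_1=a_3=1$, then also $$\lim_{\omega\to\omega_0+,\ \gamma\to\gamma_0+}J(\omega,\gamma)=-\infty .$$ Here the limits are joint limits as $(\omega,\gamma)\to(\omega_0,\gamma_0)$ with $\omega<\omega_0,\gamma<\gamma_0$ (respectively $\omega>\omega_0,\gamma>\gamma_0$), taken through $(\omega,\gamma)\in R_{\mathrm{ex}}$.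
   Context: For $a_1,a_3\in\{1,-1\}$, $\omega>0$, $\gamma\in\mathbb{R}$, set $f(s)=a_1|s|s-\gamma|s|^2s+a_3|s|^3s$, $g(s)=\omega s-f(s)$ and $G(x)=\int_0^xg(s)\,ds=\frac\omega2x^2-\frac{a_1}{3}|x|^3+\frac\gamma4x^4-\frac{a_3}{5}|x|^5$. A standing wave profile is a function $\phi=\phi_{\omega,\gamma}\in C^2(\mathbb{R})$ with $\phi''=g(\phi)$ on $\mathbb{R}$, $\phi(x)>0$ for all $x\in\mathbb{R}$ and $\lim_{x\to\pm\infty}\phi(x)=0$; it is unique up to translation when it exists. By a known criterion (Berestycki--Lions), it exists if and only if (E1) $G$ has a first (smallest) positive zero $\phi_0$, and (E2) $g(\phi_0)<0$. For fixed $(a_1,a_3)$, $R_{\mathrm{ex}}$ is the (open) set of $(\omega,\gamma)\in(0,\infty)\times\mathbb{R}$ for which a standing wave profile exists, $R_{\mathrm{no}}=((0,\infty)\times\mathbb{R})\setminus R_{\mathrm{ex}}$, and $\Gamma_{\mathrm{no}}$ is the boundary of $R_{\mathrm{no}}$ in $(0,\infty)\times\mathbb{R}$. ($\Gamma_{\mathrm{no}}$ is nonempty exactly for the three sign choices considered.) The stability functional is $$J(\omega,\gamma)=\frac{\partial}{\partial\omega}\int_{\mathbb{R}}\phi_{\omega,\gamma}(x)^2\,dx,\qquad(\omega,\gamma)\in R_{\mathrm{ex}}.$$ *)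

(* Defs.v *)
From HB Require Import structures.
From mathcomp Require Import all_boot all_order all_algebra.
From mathcomp Require Import all_classical all_reals all_analysis.
Set Implicit Arguments.
Unset Strict Implicit.
Unset Printing Implicit Defensive.
Import Order.TTheory GRing.Theory Num.Theory.
Import numFieldNormedType.Exports.
Local Open Scope classical_set_scope.
Local Open Scope ring_scope.

Definition nonlinearity (R : realType) (a1 a3 gamma s : R) : R :=
  a1 * `|s| * s - gamma * `|s| ^+ 2 * s + a3 * `|s| ^+ 3 * s.

Definition profile_rhs (R : realType) (a1 a3 omega gamma s : R) : R :=
  omega * s - nonlinearity a1 a3 gamma s.

Definition of_class_C2 (R : realType) (phi : R -> R) : Prop :=
  [/\ forall x, derivable phi x 1,
      forall x, derivable (phi^`())%classic x 1 &
      continuous (phi^`(2))%classic].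

Definition standing_wave_profile (R : realType) (a1 a3 omega gamma : R)
    (phi : R -> R) : Prop :=
  [/\ of_class_C2 phi,
      forall x, (phi^`(2))%classic x = profile_rhs a1 a3 omega gamma (phi x),
      forall x, 0 < phi x,
      phi x @[x --> +oo] --> 0 &
      phi x @[x --> -oo] --> 0].

(* Points of the parameter plane are pairs (omega, gamma). *)
Definition parameter_domain (R : realType) : set (R * R) :=
  [set p | 0 < p.1].

Definition R_ex (R : realType) (a1 a3 : R) : set (R * R) :=
  @parameter_domain R `&`
  [set p | exists phi, standing_wave_profile a1 a3 p.1 p.2 phi].

Definition R_no (R : realType) (a1 a3 : R) : set (R * R) :=
  @parameter_domain R `\` R_ex a1 a3.

(* Boundary relative to the parameter domain; that domain being open in the
   plane, this is the trace on it of the boundary taken in the plane. *)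
Definition Gamma_no (R : realType) (a1 a3 : R) : set (R * R) :=
  @parameter_domain R `&` (closure (R_no a1 a3) `\` (R_no a1 a3)^°).

(* Some profile; profiles agree up to translation, so the integral of the
   square does not depend on the choice. The default value 0 is only reached
   when there is no profile. *)
Definition profile (R : realType) (a1 a3 omega gamma : R) : R -> R :=
  xget (fun=> 0) [set phi | standing_wave_profile a1 a3 omega gamma phi].

Definition mass (R : realType) (a1 a3 omega gamma : R) : R :=
  \int[lebesgue_measure]_x (profile a1 a3 omega gamma x) ^+ 2.

(* Only meaningful on R_ex. Where the mass is not derivable in omega, derive1
   has the default value 0; a limit +oo or -oo therefore includes the
   derivability of the mass at all nearby points at which it is taken. *)
Definition J (R : realType) (a1 a3 : R) (p : R * R) : R :=
  ((fun omega => mass a1 a3 omega p.2)^`())%classic p.1.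

(* The limit of J at p through the points of R_ex lying in Q. The first
   conjunct is the usual requirement that p be a limit point of the set through
   which the limit is taken; without it the second one could be vacuous. *)
Definition J_limit (R : realType) (a1 a3 : R) (Q : set (R * R)) (p : R * R)
    (F : set_system R) : Prop :=
  closure (R_ex a1 a3 `&` Q) p /\
  J a1 a3 q @[q --> within (R_ex a1 a3 `&` Q) (nbhs p)] --> F.

(* Main.v *)
(** A profile satisfies [phi'^2 = phi^2 h(phi)] with [h(s) = omega - W(s)], [W]
    a cubic, and its maximum is the first positive zero [z] of [h], where
    [W'(z) > 0]. Parametrizing by [(z, gamma)] and substituting
    [phi = z (1 - u^2)] turns the mass into
    [4 z^(3/2) int_0^1 (1 - u^2) K(z, u^2)^(-1/2) du], where
    [K(z, w) = (W(z) - W(z (1 - w))) / (z w)] is polynomial and positive, so that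
    the mass can be differentiated under the integral sign and
    [J = (dM/dz) / W'(z)].
    At [(omega0, gamma0)] the function [h] has the double root [t], so no profile
    exists. Decreasing [omega] and [gamma] gives a zero [z] just below [t];
    increasing them removes the double root, and [z] is then close to the third
    root [c > t]. In both cases the limit of [K] vanishes to second order at one
    point [u* < 1], at which the numerator of the integrand of [dM/dz], a
    multiple of [K^(-3/2)], tends to a nonzero limit: positive in the first case
    and negative in the second. *)
Require Import Defs.
From HB Require Import structures.
From mathcomp Require Import all_boot all_order all_algebra.
From mathcomp Require Import all_classical all_reals all_analysis.
From mathcomp Require Import ring lra.
Set Implicit Arguments.
Unset Strict Implicit.
Unset Printing Implicit Defensive.
Import Order.TTheory GRing.Theory Num.Theory.
Import numFieldNormedType.Exports.
Local Open Scope classical_set_scope.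
Local Open Scope ring_scope.

(** * Calculus *)

(** All sign choices are handled by one factorization: the relations between [t], [omega0] and
    [gamma0] say that [h(s) = (t - s)^2 (A + B (t - s))] with [A = - W''(t) / 2] and [B = 2 a3 / 5],
    and the sign of [A] decides. If [A < 0 < B], the simple root precedes [t] and a neighbourhood of
    the point lies in [R_ex], which contradicts the boundary hypothesis. [A = 0] is the cusp: the
    three roots merge, and the limit [2 t A] of the numerator at [u* = 0] vanishes. So [A > 0]. The
    divergence is quantitative: on an interval of length [rho] at [u*] the perturbed [K] is at most
    of order [rho^2], so this interval contributes about [rho * rho^-3]. Elsewhere the integrand is
    bounded on the unfavourable side, because the numerator has the right sign wherever [K] is
    small. Only uniform closeness of [K] and of the numerator enters, so no relation between the
    rates of [omega] and [gamma] is imposed and the limits are joint. Since [mass] picks an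
    arbitrary profile, its formula must be proved for every profile at all nearby [omega]; hence the
    uniqueness results on the differential equation. *)

Lemma is_derive_continuous (R : realType) (f : R -> R) (x d : R) :
  is_derive x 1 f d -> {for x, continuous f}.
Proof. by case=> fx _; exact/differentiable_continuous/derivable1_diffP. Qed.

Lemma is_derive_homo (R : realType) (f df : R -> R) (x y : R) :
  (forall x : R, is_derive x 1 f (df x)) -> (forall x, 0 <= df x) ->
  x <= y -> f x <= f y.
Proof.
move=> fdf df0 xy; rewrite -subr_ge0.
have [|c _ ->] := MVT_segment xy (fun x _ => fdf x).
  by apply: continuous_subspaceT => u; exact: is_derive_continuous (fdf u).
by rewrite mulr_ge0// subr_ge0.
Qed.

Lemma is_derive_derive1 (R : realType) (f : R -> R) (x : R) :
  derivable f x 1 -> is_derive x 1 f (f^`()%classic x).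
Proof. by move=> df; rewrite derive1E; exact/derivableP. Qed.

Lemma is_derive_compose (R : realType) (f g : R -> R) (x a b : R) :
  is_derive (g x) 1 f a -> is_derive x 1 g b ->
  is_derive x 1 (fun x => f (g x)) (a * b).
Proof. by move=> df dg; exact: is_derive1_comp. Qed.

Lemma is_derive_scale (R : realType) (f : R -> R) (c x d : R) :
  is_derive x 1 f d -> is_derive x 1 (fun x => c * f x) (c * d).
Proof.
by move=> df; apply: is_derive_eq; rewrite /GRing.scale/=; ring.
Qed.

Lemma is_derive_sqr (R : realType) (x : R) :
  is_derive x 1 (fun x => x ^+ 2) (2 * x).
Proof. by apply: is_derive_eq; rewrite /GRing.scale/=; ring. Qed.

Lemma continuous_compose (R : realType) (f g : R -> R) (x : R) :
  {for x, continuous g} -> {for g x, continuous f} ->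
  {for x, continuous (fun x => f (g x))}.
Proof. by move=> cg cf; exact: continuous_comp. Qed.

Lemma is_derive_expRM (R : realType) (k x : R) :
  is_derive x 1 (fun y => expR (k * y)) (k * expR (k * x)).
Proof.
have dk : is_derive x 1 (fun y => k * y) k.
  by apply: is_derive_eq; rewrite /GRing.scale/=; ring.
by rewrite mulrC; exact: (is_derive1_comp (is_derive_expR _) dk).
Qed.

(* The energy [e] of the difference of two solutions satisfies
   [|e'| <= (1 + L) e], so that [e] vanishes identically with [e x0]. *)
Lemma ode_unique (R : realType) (phi phi' F psi psi' H : R -> R) (L x0 : R) :
  (forall x : R, is_derive x 1 phi (phi' x)) ->
  (forall x : R, is_derive x 1 phi' (F x)) ->
  (forall x : R, is_derive x 1 psi (psi' x)) ->
  (forall x : R, is_derive x 1 psi' (H x)) ->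
  (forall x, `|F x - H x| <= L * `|phi x - psi x|) ->
  phi x0 = psi x0 -> phi' x0 = psi' x0 -> phi =1 psi.
Proof.
move=> dphi ddphi dpsi ddpsi lip e0 e0'.
pose a x := phi x - psi x; pose b x := phi' x - psi' x.
have da (x : R) : is_derive x 1 a (b x) by exact: is_deriveB.
have db (x : R) : is_derive x 1 b (F x - H x) by exact: is_deriveB.
pose e x := a x ^+ 2 + b x ^+ 2.
pose e' x := 2 * a x * b x + 2 * b x * (F x - H x).
have de (x : R) : is_derive x 1 e (e' x).
  rewrite /e; apply: is_derive_eq.
  by rewrite /e' /= /GRing.scale/=; ring.
have lip' x : `|F x - H x| <= `|L| * `|a x|.
  by rewrite (le_trans (lip x))// ler_wpM2r// ler_norm.
have e_ge0 x : 0 <= e x by rewrite addr_ge0 ?sqr_ge0.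
pose C := 1 + `|L|.
have e'C x : `|e' x| <= C * e x.
  have : `|e' x| <= 2 * `|a x| * `|b x| + 2 * `|b x| * (`|L| * `|a x|).
    rewrite (le_trans (ler_normD _ _))// !normrM ger0_norm// lerD2l.
    by rewrite ler_wpM2l ?mulr_ge0.
  move=> /le_trans; apply; rewrite /C /e -(real_normK (num_real (a x))).
  rewrite -(real_normK (num_real (b x))).
  have := sqr_ge0 (`|a x| - `|b x|); have := normr_ge0 L.
  move: `|a x| `|b x| `|L| => p q l l0 pq.
  have : 0 <= l * (p - q) ^+ 2 by rewrite mulr_ge0.
  by lra.
(* Both signs of the rate [k] serve: [exp (C x) e x] is nondecreasing, so [e <= 0] before [x0], and
   [exp (- C x) e x] is nonincreasing, so [e <= 0] after it. *)
have dE k (x : R) : is_derive x 1 (fun y => expR (k * y) * e y)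
    (expR (k * x) * (k * e x + e' x)).
  have dexp := is_derive_expRM k x.
  by apply: is_derive_eq; rewrite /GRing.scale/=; ring.
have e00 : e x0 = 0 by rewrite /e /a /b e0 e0' !subrr; ring.
have e_le0 x : e x <= 0.
  have [xx0|x0x] := leP x x0.
  - have := @is_derive_homo _ _ _ x x0 (dE C) _ xx0.
    rewrite e00 mulr0 pmulr_rle0 ?expR_gt0//; apply=> y.
    rewrite mulr_ge0 ?expR_ge0//; have := e'C y; rewrite ler_norml; lra.
  - have := @is_derive_homo _ _ _ x0 x (fun x => is_deriveN (dE (- C) x)) _
    (ltW x0x).
    rewrite !opprfctE /= e00 mulr0 oppr0 oppr_ge0 pmulr_rle0 ?expR_gt0//; apply=> y.
    rewrite oppr_ge0 pmulr_rle0 ?expR_gt0//; have := e'C y; rewrite ler_norml; lra.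
move=> x; have : e x = 0 by apply/eqP; rewrite eq_le e_le0 e_ge0.
move/eqP; rewrite paddr_eq0 ?sqr_ge0// !sqrf_eq0 => /andP[+ _].
by rewrite subr_eq0 => /eqP.
Qed.

(** * Profiles *)

(** For [s >= 0] one has [G(s) = s^2 (omega - W(s)) / 2], so the positive zeros of [G] are the
    solutions of [W(s) = omega], where [W] is free of [omega]. *)
Definition potential (R : realType) (a1 a3 gamma s : R) : R :=
  2 / 3 * a1 * s - gamma / 2 * s ^+ 2 + 2 / 5 * a3 * s ^+ 3.

Lemma profile_rhsE (R : realType) (a1 a3 omega gamma s : R) : 0 <= s ->
  profile_rhs a1 a3 omega gamma s =
  omega * s - a1 * s ^+ 2 + gamma * s ^+ 3 - a3 * s ^+ 4.
Proof. by move=> s0; rewrite /profile_rhs /nonlinearity ger0_norm//; ring. Qed.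

(** A quartic is not globally Lipschitz, but a profile is positive and stays below its maximum [M];
    on that range the factor left after dividing by [r - s] is bounded. *)
Lemma profile_rhs_lipschitz (R : realType) (a1 a3 omega gamma M : R) :
  exists L, forall r s, 0 < r <= M -> 0 < s <= M ->
    `|profile_rhs a1 a3 omega gamma r - profile_rhs a1 a3 omega gamma s| <=
    L * `|r - s|.
Proof.
exists (`|omega| + `|a1| * (M + M) + `|gamma| * (M * M + M * M + M * M) +
  `|a3| * (M * M * M + M * M * M + M * M * M + M * M * M)).
move=> r s /andP[r0 rM] /andP[s0 sM].
have M0 : 0 <= M by rewrite (le_trans (ltW r0)).
rewrite !profile_rhsE ?(ltW r0) ?(ltW s0)//.
rewrite [X in `|X|](_ : _ = (omega - a1 * (r + s) +
  gamma * (r * r + r * s + s * s) -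
  a3 * (r * r * r + r * r * s + r * s * s + s * s * s)) * (r - s)); last by ring.
rewrite normrM ler_wpM2r//.
have norm_mul (a b c : R) : 0 <= b <= c -> `|a * b| <= `|a| * c.
  by case/andP=> b0 bc; rewrite normrM (ger0_norm b0) ler_wpM2l.
have r_ge0 := ltW r0; have s_ge0 := ltW s0.
have mulM (x y u v : R) : 0 <= x <= u -> 0 <= y <= v -> 0 <= x * y <= u * v.
  by case/andP=> x0 xu /andP[y0 yv]; rewrite mulr_ge0//= ler_pM.
have addM (x y u v : R) : 0 <= x <= u -> 0 <= y <= v -> 0 <= x + y <= u + v.
  by case/andP=> x0 xu /andP[y0 yv]; rewrite addr_ge0//= lerD.
have rM' : 0 <= r <= M by rewrite r_ge0.
have sM' : 0 <= s <= M by rewrite s_ge0.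
rewrite (le_trans (ler_normB _ _))// lerD//; last first.
  by apply: norm_mul; rewrite !(addM, mulM).
rewrite (le_trans (ler_normD _ _))// lerD//; last first.
  by apply: norm_mul; rewrite !(addM, mulM).
rewrite (le_trans (ler_normB _ _))// lerD//.
by apply: norm_mul; rewrite !(addM, mulM).
Qed.

Lemma is_derive_potential (R : realType) (a1 a3 gamma s : R) :
  is_derive s 1 (potential a1 a3 gamma)
    (2 / 3 * a1 - gamma * s + 6 / 5 * a3 * s ^+ 2).
Proof.
by rewrite /potential; apply: is_derive_eq; rewrite /GRing.scale/=; field.
Qed.

Lemma continuous_potential (R : realType) (a1 a3 gamma : R) :
  continuous (potential a1 a3 gamma).
Proof. by move=> s; exact: is_derive_continuous (is_derive_potential _ _ _ s). Qed.

Section profile.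
Context (R : realType) (a1 a3 omega gamma : R) (phi : R -> R).
Hypothesis prof : standing_wave_profile a1 a3 omega gamma phi.
Local Notation W := (potential a1 a3 gamma).

Lemma profile_gt0 x : 0 < phi x.
Proof. by have [] := prof. Qed.

Lemma is_derive_profile (x : R) : is_derive x 1 phi (phi^`()%classic x).
Proof. by have [[dphi _ _] _ _ _ _] := prof; rewrite derive1E;
  exact/derivableP. Qed.

Lemma is_derive_profile' (x : R) :
  is_derive x 1 (phi^`()%classic) (profile_rhs a1 a3 omega gamma (phi x)).
Proof.
have [[_ ddphi _] eqphi _ _ _] := prof.
by rewrite -eqphi derive1nS derive1n1 derive1E; exact/derivableP.
Qed.

Lemma continuous_profile : continuous phi.
Proof. by move=> x; exact: is_derive_continuous (is_derive_profile x). Qed.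

Lemma profile_small (e : R) : 0 < e ->
  exists2 C, 0 < C & forall x, C <= `|x| -> phi x < e.
Proof.
move=> e0; have [_ _ _ phiy phiNy] := prof.
have /= [A [_ Ae]] := cvgr_lt _ phiy _ e0.
have /= [B [_ Be]] := cvgr_lt _ phiNy _ e0.
exists (`|A| + `|B| + 1); first by rewrite ltr_wpDl// addr_ge0.
move=> x; have := ler_norm A; have := ler_norm (- B); rewrite normrN.
have := normr_ge0 A; have := normr_ge0 B.
have [x0|x0] := leP 0 x; last first.
  by rewrite (ltr0_norm x0) => *; apply: Be; lra.
by rewrite (ger0_norm x0) => *; apply: Ae; lra.
Qed.

Lemma profile_max : exists x0, forall x, phi x <= phi x0.
Proof.
have [C C0 phiC] := profile_small (profile_gt0 0).
have [|x0 _ max0] := @EVT_max _ phi (- C) C _ (continuous_subspaceT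
  continuous_profile).
  by lra.
have /max0 phi0 : 0 \in `[- C, C] by rewrite in_itv/=; lra.
exists x0 => x; have [xC|Cx] := leP `|x| C.
  by apply: max0; rewrite in_itv/= -ler_norml.
by rewrite (le_trans _ phi0)// ltW// phiC// ltW.
Qed.

Lemma profile_surj x0 s : 0 < s <= phi x0 -> exists x, phi x = s.
Proof.
case/andP=> s0 sphi; have [C C0 phiC] := profile_small s0.
pose y := `|x0| + C.
have phiy : phi y < s by apply: phiC; rewrite /y ger0_norm ?lerDr// addr_ge0// ltW.
have x0y : x0 <= y by rewrite /y (le_trans (ler_norm _))// lerDl ltW.
have [|x _ <-] := @IVT _ phi x0 y s x0y (continuous_subspaceT continuous_profile).
  by rewrite ge_min le_max (ltW phiy) sphi orbT.
by exists x.
Qed.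

(* The conserved energy vanishes: [phi] and, along a sequence, [phi'] tend to
   zero at infinity. *)
Lemma profile_energy x :
  (phi^`()%classic x) ^+ 2 = (phi x) ^+ 2 * (omega - W (phi x)).
Proof.
pose p := phi^`()%classic; have dphi := is_derive_profile.
have ddphi := is_derive_profile'.
pose E y := p y ^+ 2 - phi y ^+ 2 * (omega - W (phi y)).
have dE (y : R) : is_derive y 1 E 0.
  have dW := is_derive1_comp (is_derive_potential a1 a3 gamma (phi y)) (dphi y).
  apply: is_derive_eq; rewrite /GRing.scale/= profile_rhsE ?ltW ?profile_gt0//.
  by rewrite /potential /p; field.
suff E0 : E x = 0 by apply/eqP; rewrite -subr_eq0 -/p -/(E x) E0.
pose C := 1 + (`|omega| + (`|a1| + `|gamma| + `|a3|)).
have C0 : 0 < C by rewrite ltr_pwDl// !addr_ge0.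
apply/eqP; rewrite -normr_le0; apply/ler_addgt0Pr => e e0; rewrite add0r.
(* Once [phi < d <= 1], both terms of [E] are at most [d] times a constant; [C] collects these
   constants, whence [|E| <= d C <= e]. *)
pose d := Num.min 1 (e / C).
have d0 : 0 < d by rewrite lt_min ltr01 divr_gt0.
have [A A0 phiA] := profile_small d0.
have phid y : A <= y -> 0 < phi y < d.
  move=> Ay; rewrite profile_gt0/= phiA// ger0_norm//.
  by rewrite (le_trans (ltW A0)).
(* On an interval of length 1 the mean value theorem gives a point at which [phi'] is a difference
   of two small values of [phi]. *)
have [|xi] := @MVT _ phi p A (A + 1) _ (fun y _ => dphi y)
  (continuous_subspaceT continuous_profile).
  by rewrite ltrDl.
rewrite in_itv/= => /andP[Axi _]; rewrite addrAC subrr add0r mulr1 => pxi.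
have /andP[phi0 phi1] := phid _ (lexx A).
have /andP[phi2 phi3] : 0 < phi (A + 1) < d by apply: phid; rewrite lerDl.
have /andP[phi4 phi5] := phid _ (ltW Axi).
rewrite (is_derive_0_is_cst x xi dE) /E -pxi.
have d1 : d <= 1 by rewrite ge_min lexx.
have dC : d * C <= e by rewrite -ler_pdivlMr// ge_min lexx orbT.
apply: le_trans dC; move: phi0 phi1 phi2 phi3 phi4 phi5.
move: (phi A) (phi (A + 1)) (phi xi) => u v s u0 ud v0 vd s0 sd.
have Ws : `|W s| <= `|a1| + `|gamma| + `|a3|.
  rewrite /potential (le_trans (ler_normD _ _))// lerD//.
    rewrite (le_trans (ler_normB _ _))// lerD//.
      rewrite -mulrA mulrCA normrM ler_piMr// normrM gtr0_norm ?divr_gt0//.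
      rewrite gtr0_norm//; nra.
    rewrite -mulrA normrM ler_piMr// ger0_norm; nra.
  rewrite -mulrA mulrCA normrM ler_piMr// ger0_norm; nra.
have B : `|omega - W s| <= `|omega| + (`|a1| + `|gamma| + `|a3|).
  by rewrite (le_trans (ler_normB _ _))// lerD2l.
rewrite (le_trans (ler_normB _ _))// /C [leRHS]mulrDr mulr1 lerD//.
  rewrite normrX expr2 -[leRHS]mulr1.
  by rewrite ler_pM//; rewrite ler_norml; lra.
rewrite normrM ler_pM// normrX gtr0_norm//; nra.
Qed.

(* Such a profile would be constant, by uniqueness for the Cauchy problem. *)
Lemma profile_no_equilibrium x0 : phi^`()%classic x0 = 0 ->
  profile_rhs a1 a3 omega gamma (phi x0) <> 0.
Proof.
move=> p0 g0; have [xm phim] := profile_max.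
have [L lip] := profile_rhs_lipschitz a1 a3 omega gamma (phi xm).
have phi_cst : phi =1 cst (phi x0).
  apply: (@ode_unique _ _ _ (fun x => profile_rhs a1 a3 omega gamma (phi x))
    _ (cst 0) (cst 0) L x0 is_derive_profile is_derive_profile') => //.
  (* The zero second derivative of the constant solution is read as [g (phi x0)], which brings the
     Lipschitz bound into play. *)
  by move=> x /=; rewrite -{1}g0; apply: lip; rewrite profile_gt0/= phim.
have [C C0] := profile_small (profile_gt0 x0).
by move=> /(_ C); rewrite phi_cst/= ltxx ler_norm => /(_ isT).
Qed.

End profile.

(* [reduced z w] is the difference quotient of the potential between [z] and
   [z * (1 - w)]; the profile of maximum [z] is regular in the variable
   [u = sqrt w], in which the square-root singularity at the maximum is
   resolved. *)
Definition reduced (R : realType) (a1 a3 gamma z w : R) : R :=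
  2 / 3 * a1 - gamma / 2 * z * (2 - w) +
  2 / 5 * a3 * z ^+ 2 * (3 - 3 * w + w ^+ 2).

(** For [omega = W(z)] this is (E1) and (E2) with [phi_0 = z]: the values [0 < w < 1] say that
    [W < W(z)] on []0, z[], the value [w = 0] says that [W'(z) > 0], where [g(z) = - z^2 W'(z) / 2],
    and [w = 1] gives [omega > 0]. *)
Definition admissible (R : realType) (a1 a3 gamma z : R) : Prop :=
  0 < z /\ forall w, 0 <= w <= 1 -> 0 < reduced a1 a3 gamma z w.

Lemma potentialB (R : realType) (a1 a3 gamma z w : R) :
  potential a1 a3 gamma z - potential a1 a3 gamma (z * (1 - w)) =
  z * w * reduced a1 a3 gamma z w.
Proof. by rewrite /potential /reduced; field. Qed.

Lemma is_derive_reduced (R : realType) (a1 a3 gamma z w : R) :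
  is_derive w 1 (reduced a1 a3 gamma z)
    (gamma / 2 * z + 2 / 5 * a3 * z ^+ 2 * (2 * w - 3)).
Proof. by rewrite /reduced; apply: is_derive_eq; rewrite /GRing.scale/=; field. Qed.

Lemma continuous_reduced (R : realType) (a1 a3 gamma z : R) :
  continuous (reduced a1 a3 gamma z).
Proof. by move=> w; exact: is_derive_continuous (is_derive_reduced _ _ _ _ w). Qed.

Lemma reduced_bounds (R : realType) (a1 a3 gamma z : R) :
  admissible a1 a3 gamma z ->
  exists m M, 0 < m /\
    forall w, 0 <= w <= 1 -> m <= reduced a1 a3 gamma z w <= M.
Proof.
move=> [z0 K0]; have cK :=
  continuous_subspaceT (@continuous_reduced _ a1 a3 gamma z).
have [v v01 minv] := EVT_min (@ler01 R) (cK _).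
have [w w01 maxw] := EVT_max (@ler01 R) (cK _).
exists (reduced a1 a3 gamma z v), (reduced a1 a3 gamma z w); split.
  by apply: K0; move: v01; rewrite in_itv.
by move=> x x01; rewrite minv ?maxw// in_itv.
Qed.

Lemma admissible_potential_gt0 (R : realType) (a1 a3 gamma z : R) :
  admissible a1 a3 gamma z -> 0 < potential a1 a3 gamma z.
Proof.
move=> [z0 K0]; have := potentialB a1 a3 gamma z 1.
rewrite subrr mulr0 [X in _ - X](_ : _ = 0) ?subr0 ?mulr1; last first.
  by rewrite /potential; ring.
by move=> ->; rewrite mulr_gt0// K0// ler01 lexx.
Qed.

Lemma profile_max_slope (R : realType) (a1 a3 omega gamma : R) phi (x0 : R) :
  standing_wave_profile a1 a3 omega gamma phi ->
  (forall x, phi x <= phi x0) -> phi^`()%classic x0 = 0.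
Proof.
move=> prof phim; have dphi := is_derive_profile prof.
have := @derive1_at_max _ phi (x0 - 1) (x0 + 1) x0.
case; rewrite ?in_itv/= ?ltrBlDr ?ltrDl ?ltr01//=; first by lra.
by rewrite derive1E.
Qed.

(** The energy identity makes the maximum a zero of [omega - W], and there is none in []0, z[]. A
    maximum above [z] would force the profile through values slightly above [z], where [omega - W]
    is negative although it has the sign of a square. *)
Lemma profile_max_admissible (R : realType) (a1 a3 gamma z : R) phi (x0 : R) :
  admissible a1 a3 gamma z ->
  standing_wave_profile a1 a3 (potential a1 a3 gamma z) gamma phi ->
  (forall x, phi x <= phi x0) -> phi x0 = z.
Proof.
move=> [z0 K0] prof phim.
have phi0 := profile_gt0 prof x0.
have WE s : potential a1 a3 gamma z - potential a1 a3 gamma s =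
    z * (1 - s / z) * reduced a1 a3 gamma z (1 - s / z).
  by rewrite -potentialB; congr (_ - potential _ _ _ _); field; rewrite gt_eqF.
have := profile_energy prof x0; rewrite (profile_max_slope prof phim).
rewrite expr0n/= => /esym/eqP; rewrite mulf_eq0 expf_eq0/= (gt_eqF phi0)/=.
rewrite WE !mulf_eq0 (gt_eqF z0)/=.
have [phiz|zphi|//] := ltgtP (phi x0) z.
  have w1 : 0 < phi x0 / z < 1 by rewrite divr_gt0//= ltr_pdivrMr// mul1r.
  rewrite subr_eq0 gt_eqF/= ?gt_eqF//; last by lra.
  by rewrite K0//; lra.
move=> _; exfalso.
have K00 : 0 < reduced a1 a3 gamma z 0 by rewrite K0// lexx ler01.
have /nbhs_ballP[d /= d0 Kd] : \forall w \near (0 : R), 0 < reduced a1 a3 gamma z w.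
  exact: (cvgr_gt _ (@continuous_reduced _ a1 a3 gamma z 0) _ K00).
(* The value [z (1 + e)] must be at most the maximum, and [w = - e], outside [[0, 1]], must lie
   where [K] is still positive by continuity. *)
pose e := Num.min (d / 2) (phi x0 / z - 1).
have e0 : 0 < e.
  by rewrite lt_min divr_gt0//= subr_gt0 ltr_pdivlMr// mul1r.
have sphi : 0 < z * (1 + e) <= phi x0.
  rewrite mulr_gt0 ?addr_gt0//= mulrC -ler_pdivlMr// -lerBrDl.
  by rewrite ge_min lexx orbT.
have [x phix] := profile_surj prof sphi.
have := profile_energy prof x; rewrite phix WE.
rewrite (_ : 1 - z * (1 + e) / z = - e); last by field; rewrite gt_eqF.
have Ke : 0 < reduced a1 a3 gamma z (- e).
  apply: Kd; rewrite /ball/= sub0r opprK gtr0_norm//.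
  by rewrite gt_min ltr_pdivrMr// ltr_pMr// ltr1n.
have : 0 < (z * (1 + e)) ^+ 2 by rewrite exprn_gt0; case/andP: sphi.
have := sqr_ge0 (phi^`()%classic x).
move: (_ ^+ 2) => p p0 q0 pE; move: p0; rewrite pE pmulr_rge0//.
by rewrite mulrN mulNr oppr_ge0 leNgt !mulr_gt0.
Qed.

(** The equation is autonomous and of even order, so translations and reflections preserve it and
    equal Cauchy data decide. With [b = 1] this compares two profiles; with [b = -1] it shows that a
    profile is even about its maximum. *)
Lemma profile_unique (R : realType) (a1 a3 omega gamma : R) phi psi
    (x0 y0 b : R) :
  standing_wave_profile a1 a3 omega gamma phi ->
  standing_wave_profile a1 a3 omega gamma psi ->
  phi x0 = psi y0 -> phi^`()%classic x0 = 0 -> psi^`()%classic y0 = 0 ->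
  b ^+ 2 = 1 -> forall x, phi (x0 + x) = psi (y0 + b * x).
Proof.
move=> prof qrof e0 phi0 psi0 bb.
have [xm phim] := profile_max prof; have [ym psim] := profile_max qrof.
have [L lip] := profile_rhs_lipschitz a1 a3 omega gamma
  (Num.max (phi xm) (psi ym)).
have dsh c e (x : R) : is_derive x 1 (fun x => c + e * x) e.
  by apply: is_derive_eq; rewrite /GRing.scale/=; ring.
have shift (f f' : R -> R) (c e : R) : (forall x : R, is_derive x 1 f (f' x)) ->
    forall x : R, is_derive x 1 (fun x => f (c + e * x)) (f' (c + e * x) * e).
  by move=> df x; exact: (is_derive1_comp (df _) (dsh c e x)).
have scale (f f' : R -> R) : (forall x : R, is_derive x 1 f (f' x)) ->
    forall x : R, is_derive x 1 (fun x => f x * b) (f' x * b).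
  by move=> df x; apply: is_derive_eq; rewrite /GRing.scale/=; ring.
have dphi1 := shift _ _ x0 1 (is_derive_profile prof).
have dphi2 (x : R) : is_derive x 1 (fun x => phi^`()%classic (x0 + 1 * x) * 1)
    (profile_rhs a1 a3 omega gamma (phi (x0 + 1 * x))).
  under eq_fun do rewrite mulr1; rewrite -[profile_rhs _ _ _ _ _]mulr1.
  exact: (shift _ _ x0 1 (is_derive_profile' prof)).
have dpsi1 := shift _ _ y0 b (is_derive_profile qrof).
have dpsi2 := scale _ _ (shift _ _ y0 b (is_derive_profile' qrof)).
have mul11 u : u * 1 * 1 = u :> R by rewrite !mulr1.
suff : (fun x => phi (x0 + 1 * x)) =1 (fun x => psi (y0 + b * x)).
  by move=> E x; rewrite -E mul1r.
apply: (ode_unique dphi1 dphi2 dpsi1 dpsi2 (L := L) (x0 := 0)).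
- move=> x; rewrite -mulrA -expr2 bb mulr1.
  by apply: lip; rewrite ?(profile_gt0 prof) ?(profile_gt0 qrof) le_max ?phim
    ?psim ?orbT.
- by rewrite !mulr0 !addr0.
- by rewrite !mulr0 !addr0 phi0 psi0 !mul0r.
Qed.

(** * Autonomous equations and the hyperbolic tangent *)

Lemma integrable_subr (R : realType) (D : set (measurableTypeR R)) (f g : R -> R) :
  measurable D ->
  (@lebesgue_measure R).-integrable D (EFin \o f) ->
  (@lebesgue_measure R).-integrable D (EFin \o g) ->
  (@lebesgue_measure R).-integrable D (EFin \o (fun x => f x - g x)).
Proof. by move=> mD fi gi; exact: (integrableB mD fi gi). Qed.

Lemma integrable_scale (R : realType) (D : set (measurableTypeR R)) (c : R) (f
  : R -> R) :
  measurable D ->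
  (@lebesgue_measure R).-integrable D (EFin \o f) ->
  (@lebesgue_measure R).-integrable D (EFin \o (fun x => c * f x)).
Proof. by move=> mD fi; exact: (integrableZl mD c fi). Qed.

Lemma continuous_integrable_itv (R : realType) (f : R -> R) (a b : R) :
  {within `[a, b], continuous f} ->
  (@lebesgue_measure R).-integrable `[a, b] (EFin \o f).
Proof. by move=> cf; apply: continuous_compact_integrable => //;
  exact: segment_compact. Qed.

Lemma is_derive_integral (R : realType) (f : R -> R) (a x u : R) :
  (@lebesgue_measure R).-integrable `[a, u] (EFin \o f) ->
  a < x < u -> {for x, continuous f} ->
  is_derive x 1 (fun y => \int[@lebesgue_measure R]_(t in `[a, y]) f t) (f x).
Proof.
move=> intf /andP[ax xu] cf.
have [dF Fx] := continuous_FTC1_closed xu intf ax cf.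
by apply: DeriveDef => //; rewrite -derive1E.
Qed.

(** The integral over [[a, x]] is zero for [x < a], so the base point moves to the left with [x];
    subtracting the value at 0 makes the result independent of the base point. *)
Lemma continuous_primitive (R : realType) (f : R -> R) : continuous f ->
  exists F : R -> R, forall x : R, is_derive x 1 F (f x).
Proof.
move=> cf.
have intf a b : (@lebesgue_measure R).-integrable `[a, b] (EFin \o f).
  by apply: continuous_integrable_itv; exact: continuous_subspaceT.
pose P a x := \int[@lebesgue_measure R]_(t in `[a, x]) f t.
have dP a (x : R) : a < x -> is_derive x 1 (P a) (f x).
  move=> ax; apply: (is_derive_integral (intf a (x + 1)) _ (cf x)).
  by rewrite ax ltrDl ltr01.
have Pab a b x : a <= b -> b <= x -> P a x = P a b + P b x.
  move=> ab bx; apply/eqP; rewrite addrC -subr_eq; apply/eqP; rewrite /P.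
  rewrite Rintegral_itvB ?bnd_simp//; apply: Rintegral_itv_obnd_cbnd.
  apply: integrableS (intf b x) => //= t /=.
  by rewrite !in_itv/= => /andP[/ltW -> ->].
pose G x := P (- (`|x| + 1)) x - P (- (`|x| + 1)) 0.
have GE a x : a <= - (`|x| + 1) -> G x = P a x - P a 0.
  move=> ax; have := ler_normr x x; have := ler_norm (- x);
    rewrite normrN lexx/= => h1 h2.
  have n0 := normr_ge0 x.
  rewrite /G (Pab a (- (`|x| + 1)) x)//; last by lra.
  have -> : P a 0 = P a (- (`|x| + 1)) + P (- (`|x| + 1)) 0 by apply: Pab; lra.
  by ring.
exists G => x.
pose a := - (`|x| + 2).
have ax : a < x.
  by rewrite /a; have := ler_norm (- x); rewrite normrN; lra.
apply: (@near_eq_is_derive _ _ _ (fun y => P a y - P a 0)).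
  have /nbhs_ballP[e /= e0 near1] : \forall y \near x, `|y - x| < 1.
    by near=> y; rewrite distrC; near: y; exact: nbhsx_ballx.
  apply/nbhs_ballP; exists e => //= y /near1 yx1; apply/esym/GE; rewrite /a.
  have := ler_normD (y - x) x; rewrite subrK; lra.
have dPx := dP a x ax.
by apply: is_derive_eq; rewrite subr0.
Unshelve. all: by end_near. Qed.

(* The solution is the inverse of a primitive of [1 / f]. *)
Lemma autonomous_solution (R : realType) (f : R -> R) (M : R) :
  continuous f -> (forall x, 0 < f x <= M) ->
  exists2 th : R -> R, th 0 = 0 & forall x : R, is_derive x 1 th (f (th x)).
Proof.
move=> cf f0M.
have f0 x : 0 < f x by case/andP: (f0M x).
have M0 : 0 < M by case/andP: (f0M 0) => /lt_le_trans h /h.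
have [G0 dG0] : exists F : R -> R, forall x : R, is_derive x 1 F (f x)^-1.
  by apply: continuous_primitive => x; apply: cvgV; [rewrite gt_eqF|exact: cf].
pose G x := G0 x - G0 0.
have dG (x : R) : is_derive x 1 G (f x)^-1.
  by have := dG0 x => ?; apply: is_derive_eq; rewrite subr0.
have G00 : G 0 = 0 by rewrite /G subrr.
have cG : continuous G by move=> x; exact: is_derive_continuous (dG x).
have ltG x y : x < y -> G x < G y.
  move=> xy; rewrite -subr_gt0.
  have [c _ ->] := MVT xy (fun x _ => dG x) (continuous_subspaceT cG).
  by rewrite mulr_gt0 ?invr_gt0 ?subr_gt0.
have injG x y : G x = G y -> x = y.
  by move=> E; have [/ltG|/ltG|//] := ltgtP x y; rewrite E ltxx.
(* The upper bound [M] of [f] keeps the slope of [G] at least [1 / M], so [G] is onto and its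
   inverse is defined for all times. *)
have slope x y : x <= y -> (y - x) / M <= G y - G x.
  move=> xy.
  have dH (u : R) : is_derive u 1 (fun u => G u - M^-1 * u) ((f u)^-1 - M^-1).
    by have := dG u => ?; apply: is_derive_eq; rewrite /GRing.scale/=; ring.
  have : G x - M^-1 * x <= G y - M^-1 * y.
    apply: is_derive_homo dH _ xy => u.
    by rewrite subr_ge0 lef_pV2 ?posrE//; case/andP: (f0M u).
  by rewrite mulrC; lra.
have surjG y : exists x, G x = y.
  have y0 := normr_ge0 y.
  have [||x _ <-] := @IVT _ G (- (M * `|y|)) (M * `|y|) y _
    (continuous_subspaceT cG).
  - by rewrite ge0_cp// mulr_ge0// ltW.
  - have My : 0 <= M * `|y| by rewrite mulr_ge0// ltW.
    have := slope 0 (M * `|y|) My;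
      rewrite G00 !subr0 mulrAC divff ?gt_eqF// mul1r => h1.
    have := slope (- (M * `|y|)) 0; rewrite oppr_le0 => /(_ My).
    rewrite G00 opprK add0r mulrAC divff ?gt_eqF// mul1r => h2.
    have := ler_norm y; have := ler_norm (- y); rewrite normrN => *.
    by rewrite ge_min le_max; apply/andP; split; apply/orP; [left|right]; lra.
  - by exists x.
have [th thK] := choice surjG.
exists th; first by apply: injG; rewrite thK.
move=> y; rewrite -{1}(thK y) -[f _]invrK.
apply: is_derive_inverse (dG _) _.
- by near=> x; apply: injG; rewrite thK.
- by near=> x; exact: cG.
- by rewrite invr_neq0// gt_eqF.
Unshelve. all: by end_near. Qed.

Definition tanh (R : realType) (x : R) : R := 1 - 2 / (expR (2 * x) + 1).

Lemma is_derive_tanh (R : realType) (x : R) :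
  is_derive x 1 (@tanh R) (1 - tanh x ^+ 2).
Proof.
have e0 : expR (2 * x) + 1 != 0 by rewrite gt_eqF// addr_gt0// expR_gt0.
have de := is_derive_expRM 2 x.
have dV : is_derive x 1 (fun x => (expR (2 * x) + 1)^-1)
    (- (expR (2 * x) + 1) ^- 2 *: (2 * expR (2 * x))).
  by apply: is_deriveV => //; apply: is_derive_eq; rewrite addr0.
by rewrite /tanh; apply: is_derive_eq; rewrite /GRing.scale/=; field.
Qed.

Lemma tanh0 (R : realType) : tanh 0 = 0 :> R.
Proof. by rewrite /tanh mulr0 expR0 (_ : 1 + 1 = 2)// divff// subrr. Qed.

Lemma tanh_bounds (R : realType) (x : R) : - 1 < tanh x < 1.
Proof.
have e0 := expR_gt0 (2 * x); rewrite /tanh.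
have : 0 < 2 / (expR (2 * x) + 1) < 2.
  by rewrite divr_gt0 ?addr_gt0//= ltr_pdivrMr ?addr_gt0// ltr_pMr// ltrDr.
by lra.
Qed.

Lemma tanh_sqr_bounds (R : realType) (x : R) : 0 <= tanh x ^+ 2 < 1.
Proof. by rewrite sqr_ge0/=; have := tanh_bounds x; nra. Qed.

Lemma tanh_gt0 (R : realType) (x : R) : 0 < x -> 0 < tanh x.
Proof.
move=> x0; rewrite /tanh subr_gt0 ltr_pdivrMr ?addr_gt0 ?expR_gt0// mul1r.
rewrite -ltrBlDr (_ : 2 - 1 = 1 :> R); last by ring.
by rewrite expR_gt1 mulr_gt0.
Qed.

Lemma tanhN (R : realType) (x : R) : tanh (- x) = - tanh x.
Proof.
rewrite /tanh mulrN expRN; have := expR_gt0 (2 * x).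
by move: (expR _) => e e0; field; rewrite !gt_eqF ?addr_gt0.
Qed.

Lemma cvg_tanh (R : realType) : @tanh R x @[x --> +oo] --> (1 : R).
Proof.
rewrite -[X in _ --> X]subr0; apply: cvgB; first exact: cvg_cst.
rewrite -(mulr0 2); apply: cvgM; first exact: cvg_cst.
apply/cvgrPdist_lt => e e0; near=> x.
have x0 : 0 < x by near: x; apply: nbhs_pinfty_gt; exact: num_real.
rewrite sub0r normrN gtr0_norm ?invr_gt0 ?addr_gt0 ?expR_gt0//.
rewrite invf_plt ?posrE ?addr_gt0 ?expR_gt0//.
have : e^-1 < x by near: x; apply: nbhs_pinfty_gt; exact: num_real.
by have := expR_ge1Dx (2 * x); lra.
Unshelve. all: by end_near. Qed.

(** * Existence of profiles and the mass *)

Definition mass_density (R : realType) (a1 a3 gamma z u : R) : R :=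
  (1 - u ^+ 2) / Num.sqrt (reduced a1 a3 gamma z (u ^+ 2)).

Definition mass_integral (R : realType) (a1 a3 gamma z : R) : R :=
  4 * z * Num.sqrt z *
  \int[lebesgue_measure]_(u in `[0, 1]) mass_density a1 a3 gamma z u.

Lemma continuous_mass_density (R : realType) (a1 a3 gamma z u : R) :
  0 < reduced a1 a3 gamma z (u ^+ 2) ->
  {for u, continuous (mass_density a1 a3 gamma z)}.
Proof.
move=> K0; rewrite /mass_density; apply: cvgM.
  by apply: cvgB; [exact: cvg_cst|exact: is_derive_continuous (is_derive_sqr u)].
apply: cvgV; first by rewrite gt_eqF// sqrtr_gt0.
apply: (@continuous_compose _ Num.sqrt (fun u => reduced a1 a3 gamma z (u ^+ 2))).
  apply: (@continuous_compose _ _ (fun u => u ^+ 2)).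
    exact: is_derive_continuous (is_derive_sqr u).
  exact: continuous_reduced.
exact: sqrt_continuous.
Qed.

Section mass_primitive.
Context (R : realType) (a1 a3 gamma z : R).
Hypothesis adm : admissible a1 a3 gamma z.
Local Notation q := (mass_density a1 a3 gamma z).
Let S v := \int[@lebesgue_measure R]_(u in `[0, v]) q u.

Lemma sqr_in01 (u : R) : 0 <= u <= 1 -> 0 <= u ^+ 2 <= 1.
Proof. by move=> ?; nra. Qed.

Lemma mass_density_integrable :
  (@lebesgue_measure R).-integrable `[0, 1] (EFin \o q).
Proof.
apply: continuous_integrable_itv; apply: continuous_in_subspaceT => u.
rewrite inE/= in_itv/= => /sqr_in01 u01; apply: continuous_mass_density.
by case: adm => _; apply.
Qed.

Lemma mass_primitive_continuous : {within `[0, 1], continuous S}.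
Proof. exact: parameterized_integral_continuous ler01 mass_density_integrable. Qed.

Lemma is_derive_mass_primitive (v : R) : 0 < v < 1 -> is_derive v 1 S (q v).
Proof.
move=> v01; apply: (is_derive_integral mass_density_integrable v01).
apply: continuous_mass_density; case: adm => _; apply; apply: sqr_in01.
by case/andP: v01 => /ltW -> /ltW ->.
Qed.

Lemma mass_primitive0 : S 0 = 0.
Proof. by rewrite /S set_itv1 Rintegral_set1. Qed.

(** Continuity of [S] is known only relative to [[0, 1]], hence the condition that [f] stays there;
    the limits taken later are at the two end points. *)
Lemma cvg_mass_primitive (T : Type) (F : set_system T) (FF : Filter F)
    (f : T -> R) (v : R) :
  0 <= v <= 1 -> (\forall x \near F, 0 <= f x <= 1) ->
  f x @[x --> F] --> v -> S (f x) @[x --> F] --> S v.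
Proof.
move=> v01 f01 fv.
have /subspace_continuousP/(_ v) := mass_primitive_continuous.
rewrite /= in_itv/= => /(_ v01) Sv.
apply: (@cvg_comp _ _ _ f S _ _ _ _ Sv) => A /= /fv fA.
have {}fA : \forall x \near F, f x \in `[0, 1] -> A (f x) := fA.
by apply: filterS2 f01 fA => x fx Afx; apply: Afx; rewrite in_itv/=.
Qed.

End mass_primitive.

(* [y = tanh o th] solves [y' = (1 - y^2) sqrt (z K(y^2)) / 2], which is the
   equation [phi'^2 = phi^2 (W z - W phi)] for [phi = z (1 - y^2)]. *)
Section soliton.
Context (R : realType) (a1 a3 gamma z : R).
Hypothesis adm : admissible a1 a3 gamma z.
Local Notation W := (potential a1 a3 gamma).
Local Notation K := (reduced a1 a3 gamma z).
Let slope (t : R) := Num.sqrt (z * K (tanh t ^+ 2)) / 2.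

Let z0 : 0 < z. Proof. by case: adm. Qed.

Lemma reduced_tanh_gt0 (t : R) : 0 < K (tanh t ^+ 2).
Proof.
case: adm => _; apply.
by have /andP[-> /ltW] := tanh_sqr_bounds t.
Qed.

Lemma continuous_tanh : continuous (@tanh R).
Proof. by move=> t; exact: is_derive_continuous (is_derive_tanh t). Qed.

Lemma slope_continuous : continuous slope.
Proof.
move=> t; rewrite /slope; apply: cvgM; last exact: cvg_cst.
apply: (@continuous_compose _ Num.sqrt (fun t => z * K (tanh t ^+ 2))).
  apply: cvgM; first exact: cvg_cst.
  apply: (@continuous_compose _ _ (fun t => tanh t ^+ 2)).
    apply: (@continuous_compose _ (fun x => x ^+ 2)); first exact: continuous_tanh.
    exact: is_derive_continuous (is_derive_sqr _).
  exact: continuous_reduced.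
exact: sqrt_continuous.
Qed.

Lemma slope_bounds : exists m M, 0 < m /\ forall t, m <= slope t <= M.
Proof.
have [m [M [m0 KmM]]] := reduced_bounds adm.
exists (Num.sqrt (z * m) / 2), (Num.sqrt (z * M) / 2).
split; first by rewrite divr_gt0// sqrtr_gt0 mulr_gt0.
move=> t; have /andP[t0 /ltW t1] := tanh_sqr_bounds t.
have /andP[Km KM] : m <= K (tanh t ^+ 2) <= M by apply: KmM; rewrite t0.
by rewrite /slope !ler_pM2r ?invr_gt0// !ler_wsqrtr// ler_pM2l.
Qed.

(** The factor [1 - y^2], which vanishes at the limits of [y], is the derivative of [tanh]. The
    angle [th] therefore moves at a speed between two positive constants: it exists for all [x] and
    is unbounded. *)
Lemma soliton_angle : exists2 th : R -> R, th 0 = 0 &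
  forall x : R, is_derive x 1 th (slope (th x)).
Proof.
have [m [M [m0 smM]]] := slope_bounds.
apply: (@autonomous_solution _ slope M slope_continuous) => x.
by have /andP[/(lt_le_trans m0) -> ->] := smM x.
Qed.

Section angle.
Variable th : R -> R.
Hypothesis th0 : th 0 = 0.
Hypothesis dth : forall x : R, is_derive x 1 th (slope (th x)).
Let y x := tanh (th x).
Let r x := Num.sqrt (z * K (y x ^+ 2)).
Let psi x := z * (1 - y x ^+ 2).
Let psi' x := - (z * (y x * ((1 - y x ^+ 2) * r x))).

Let r0 x : 0 < r x.
Proof. by rewrite sqrtr_gt0 mulr_gt0// reduced_tanh_gt0. Qed.

Let r2 x : r x ^+ 2 = z * K (y x ^+ 2).
Proof. by rewrite sqr_sqrtr// ltW// mulr_gt0// reduced_tanh_gt0. Qed.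

Lemma angle_growth : exists2 m, 0 < m & forall x, 0 <= x -> m * x <= th x.
Proof.
have [m [M [m0 smM]]] := slope_bounds; exists m => // x x0.
have dH (u : R) : is_derive u 1 (fun u => th u - m * u) (slope (th u) - m).
  by have := dth u => ?; apply: is_derive_eq; rewrite /GRing.scale/=; ring.
have := is_derive_homo dH _ x0; rewrite th0 mulr0 subrr subr_ge0; apply=> u.
by rewrite subr_ge0; case/andP: (smM (th u)).
Qed.

Lemma cvg_angle : y x @[x --> +oo] --> (1 : R).
Proof.
have [m m0 thm] := angle_growth.
suff thy : th x @[x --> +oo] --> +oo by apply: cvg_comp thy _; exact: cvg_tanh.
apply/cvgryPge => A; near=> x.
have x0 : 0 <= x by near: x; apply: nbhs_pinfty_ge; exact: num_real.
apply: le_trans (thm _ x0); rewrite mulrC -ler_pdivrMr//.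
Unshelve. all: by end_near. Qed.

Lemma angle_in01 x : 0 < x -> 0 < y x < 1.
Proof.
move=> x0; have [m m0 thm] := angle_growth.
have -> : y x < 1 by case/andP: (tanh_bounds (th x)).
by rewrite tanh_gt0// (lt_le_trans _ (thm _ (ltW x0)))// mulr_gt0.
Qed.

Lemma is_derive_tanh_angle (x : R) :
  is_derive x 1 y ((1 - y x ^+ 2) * (r x / 2)).
Proof. exact: (is_derive1_comp (is_derive_tanh (th x)) (dth x)). Qed.

Lemma is_derive_soliton (x : R) : is_derive x 1 psi (psi' x).
Proof.
have := is_derive_tanh_angle x => dy.
by rewrite /psi /psi'; apply: is_derive_eq; rewrite /GRing.scale/=; field.
Qed.

Lemma is_derive_soliton' (x : R) :
  is_derive x 1 psi' (profile_rhs a1 a3 (W z) gamma (psi x)).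
Proof.
have := is_derive_tanh_angle x => dy.
have dy2 : is_derive x 1 (fun x => y x ^+ 2) (2 * y x * ((1 - y x ^+ 2) * (r x
  / 2))).
  exact: (is_derive_compose (is_derive_sqr (y x)) dy).
have dK := @is_derive_compose _ _ (fun x => y x ^+ 2) _ _ _
  (is_derive_reduced a1 a3 gamma z (y x ^+ 2)) dy2.
have dzK : is_derive x 1 (fun x => z * K (y x ^+ 2))
   (z * ((gamma / 2 * z + 2 / 5 * a3 * z ^+ 2 * (2 * y x ^+ 2 - 3)) *
    (2 * y x * ((1 - y x ^+ 2) * (r x / 2))))).
  exact: is_derive_scale.
have zK0 : 0 < z * K (y x ^+ 2) by rewrite mulr_gt0// reduced_tanh_gt0.
have dr := @is_derive_compose _ _ (fun x => z * K (y x ^+ 2)) _ _ _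
  (is_derive1_sqrt zK0) dzK.
rewrite -/(r x) in dr.
(* The factor [r] in [y'] cancels the [1 / r] of the derivative of the square root. *)
have {}dr : is_derive x 1 r ((gamma / 2 * z + 2 / 5 * a3 * z ^+ 2 * (2 * y x ^+
  2 - 3)) *
    (z * y x * (1 - y x ^+ 2) / 2)).
  by apply: is_derive_eq dr _; field; rewrite gt_eqF.
rewrite /psi'; apply: is_derive_eq.
rewrite profile_rhsE; last first.
  by rewrite mulr_ge0 ?ltW// subr_gt0; case/andP: (tanh_sqr_bounds (th x)).
rewrite /GRing.scale/=.
(* Now [r] occurs only squared, so it can be replaced by the polynomial [z K]. *)
apply: (@eq_trans _ _ (- z * ((1 - y x ^+ 2) * (1 - 3 * y x ^+ 2) * r x ^+ 2 / 2 +
   y x ^+ 2 * (1 - y x ^+ 2) ^+ 2 * z *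
   (gamma / 2 * z + 2 / 5 * a3 * z ^+ 2 * (2 * y x ^+ 2 - 3)) / 2))).
  by field.
by rewrite r2 /psi /reduced /potential; field.
Qed.

Lemma soliton_gt0 x : 0 < psi x.
Proof. by rewrite mulr_gt0// subr_gt0; case/andP: (tanh_sqr_bounds (th x)). Qed.

Lemma soliton0 : psi 0 = z.
Proof. by rewrite /psi /y th0 tanh0 expr0n/= subr0 mulr1. Qed.

Lemma cvg_soliton : psi x @[x --> +oo] --> 0.
Proof.
rewrite -(mulr0 z) -(subrr 1) -{2}(expr1n R 2); apply: cvgM; first exact: cvg_cst.
apply: cvgB; first exact: cvg_cst.
by apply: (@cvg_comp _ _ _ y (fun y => y ^+ 2) _ _ _ cvg_angle);
  exact: is_derive_continuous (is_derive_sqr 1).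
Qed.

(** [2 z^(3/2) S(y x)] is a primitive of [psi^2]: the factor [sqrt K] of [y'] cancels the
    denominator of the density. Since [y] goes from 0 to the limit 1, the improper integral is the
    increment [S 1 - S 0] times the constant. *)
Lemma soliton_half_mass :
  (\int[lebesgue_measure]_(x in `[0%R, +oo[) (psi x ^+ 2)%:E =
  (2 * z * Num.sqrt z *
   \int[lebesgue_measure]_(u in `[0, 1]) mass_density a1 a3 gamma z u)%:E)%E.
Proof.
pose S v := \int[@lebesgue_measure R]_(u in `[0, v]) mass_density a1 a3 gamma z u.
have S0 : S 0 = 0 by exact: mass_primitive0.
have c0 : continuous psi by move=> x;
  exact: is_derive_continuous (is_derive_soliton x).
have y01 x : 0 <= x -> 0 <= y x <= 1.
  rewrite le_eqVlt => /orP[/eqP <-|/angle_in01/andP[/ltW -> /ltW ->]//].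
  by rewrite /y th0 tanh0 lexx ler01.
have dF (x : R) : 0 < x -> is_derive x 1 (fun x => 2 * z * Num.sqrt z * S (y
  x)) (psi x ^+ 2).
  move=> /angle_in01 yx; have dS := is_derive_mass_primitive adm yx.
  have dSy := is_derive_compose dS (is_derive_tanh_angle x).
  apply: is_derive_eq (is_derive_scale (2 * z * Num.sqrt z) dSy) _.
  rewrite /mass_density /psi /r sqrtrM ?ltW//.
  have : 0 < Num.sqrt (K (y x ^+ 2)) by rewrite sqrtr_gt0 reduced_tanh_gt0.
  have := sqr_sqrtr (ltW z0); move: (Num.sqrt z) (Num.sqrt _) => b k <- k0.
  by field; rewrite gt_eqF.
rewrite (@ge0_continuous_FTC2y _ (fun x => psi x ^+ 2)
  (fun x => 2 * z * Num.sqrt z * S (y x)) 0 (2 * z * Num.sqrt z * S 1)).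
- have -> : y 0 = 0 by rewrite /y th0 tanh0.
  by rewrite S0 mulr0 sube0.
- by move=> x _; rewrite sqr_ge0.
- apply: continuous_subspaceT => x.
  exact: (continuous_comp (c0 x) (is_derive_continuous (is_derive_sqr _))).
- apply: cvgM; first exact: cvg_cst.
  apply: (cvg_mass_primitive adm) cvg_angle; first by rewrite ler01 lexx.
  by near=> x; apply: y01; near: x; apply: nbhs_pinfty_ge; exact: num_real.
- by move=> x /dF [].
- apply: cvgM; first exact: cvg_cst.
  apply: (cvg_mass_primitive adm); first exact: y01.
    by near=> x; apply: y01; near: x; exact: nbhs_right_ge.
  apply: cvg_at_right_filter; exact: is_derive_continuous (is_derive_tanh_angle 0).
- by move=> x; rewrite in_itv/= andbT => /dF [_ <-]; rewrite derive1E.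
Unshelve. all: by end_near. Qed.

End angle.

Lemma soliton_profile (th : R -> R) : th 0 = 0 ->
  (forall x : R, is_derive x 1 th (slope (th x))) ->
  standing_wave_profile a1 a3 (W z) gamma (fun x => z * (1 - tanh (th x) ^+ 2)).
Proof.
move=> th0 dth; set psi := fun x => _.
have d1 := is_derive_soliton dth; have d2 := is_derive_soliton' dth.
have psiE' : psi^`()%classic = fun x =>
    - (z * (tanh (th x) * ((1 - tanh (th x) ^+ 2) *
      Num.sqrt (z * K (tanh (th x) ^+ 2))))).
  by apply/funext => x; rewrite derive1E; case: (d1 x).
have psiE2 : psi^`(2)%classic = fun x => profile_rhs a1 a3 (W z) gamma (psi x).
  apply/funext => x; rewrite derive1nS derive1n1 psiE' derive1E.
  by case: (d2 x).
have cpsi : continuous psi by move=> x; exact: is_derive_continuous (d1 x).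
have psi0 x : 0 < psi x by exact: soliton_gt0.
split => //.
- split.
  + by move=> x; case: (d1 x).
  + by move=> x; rewrite psiE'; case: (d2 x).
  + rewrite psiE2 (_ : (fun x => _) = fun x => W z * psi x - a1 * psi x ^+ 2 +
        gamma * psi x ^+ 3 - a3 * psi x ^+ 4); last first.
      by apply/funext => x; rewrite profile_rhsE// ltW.
    pose g (s : R) := W z * s - a1 * s ^+ 2 + gamma * s ^+ 3 - a3 * s ^+ 4.
    have dg (s : R) : is_derive s 1 g
        (W z - 2 * a1 * s + 3 * gamma * s ^+ 2 - 4 * a3 * s ^+ 3).
      by rewrite /g; apply: is_derive_eq; rewrite /GRing.scale/=; ring.
    move=> x; apply: (@continuous_compose _ g psi); first exact: cpsi.
    exact: is_derive_continuous (dg _).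
- by move=> x; rewrite psiE2.
- exact: cvg_soliton th0 dth.
- apply/cvgNy_compNP.
  (* [slope] depends on [tanh] only through its square, so the reflected angle solves the same
     equation and the limit at [-oo] follows from the one at [+oo]. *)
  pose ph x := - th (- x).
  have ph0 : ph 0 = 0 by rewrite /ph oppr0 th0 oppr0.
  have dph (x : R) : is_derive x 1 ph (slope (ph x)).
    have dN : is_derive x 1 (fun x : R => - x) (-1) by apply: is_derive_eq.
    have := is_deriveN (is_derive_compose (dth (- x)) dN).
    by rewrite mulrN1 opprK /slope /ph tanhN sqrrN.
  have := cvg_soliton ph0 dph.
  suff -> : psi \o -%R = fun x => z * (1 - tanh (ph x) ^+ 2) by [].
  by apply/funext => x /=; rewrite /psi /ph tanhN sqrrN.
Qed.

Lemma profile_exists : exists2 psi,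
  standing_wave_profile a1 a3 (W z) gamma psi &
  psi 0 = z /\ psi^`()%classic 0 = 0 /\
  \int[lebesgue_measure]_x (psi x ^+ 2) = mass_integral a1 a3 gamma z.
Proof.
have [th th0 dth] := soliton_angle.
exists (fun x => z * (1 - tanh (th x) ^+ 2)); first exact: soliton_profile.
have prof := soliton_profile th0 dth.
set psi := (fun x : R => _) in prof *.
have psi0 : psi 0 = z by exact: soliton0.
have dpsi0 : psi^`()%classic 0 = 0.
  have [_] := is_derive_soliton dth 0; rewrite -derive1E => ->.
  by rewrite th0 tanh0 mul0r mulr0 oppr0.
split=> //; split=> //.
(* Uniqueness with [b = -1]; the full mass is then twice the half-line integral. *)
have even x : psi x ^+ 2 = psi (- x) ^+ 2.
  have := profile_unique prof prof (erefl (psi 0)) dpsi0 dpsi0 (etrans (sqrrN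
    1) (expr1n R 2)) x.
  by rewrite !add0r mulN1r => ->.
have cpsi := continuous_profile prof.
have csq : continuous (fun x : R => psi x ^+ 2).
  move=> x; apply: (@continuous_compose _ (fun y => y ^+ 2)); first exact: cpsi.
  exact: exprn_continuous.
rewrite /Rintegral ge0_symfun_integralT//; last by move=> x; rewrite sqr_ge0.
rewrite -set_itvcy (soliton_half_mass th0 dth) -EFinM /= /mass_integral.
by ring.
Qed.

End soliton.

(** The profile picked by [xget] has maximum [z], so it is a translate of the explicit one, and
    translation preserves the integral. *)
Lemma massE (R : realType) (a1 a3 gamma z : R) : admissible a1 a3 gamma z ->
  mass a1 a3 (potential a1 a3 gamma z) gamma = mass_integral a1 a3 gamma z.
Proof.
move=> adm; have [psi psiP [psi0 [dpsi0 <-]]] := profile_exists adm.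
set phi := profile a1 a3 (potential a1 a3 gamma z) gamma.
have phiP : standing_wave_profile a1 a3 (potential a1 a3 gamma z) gamma phi.
  by apply: (@xgetPex _ _ [set phi | standing_wave_profile _ _ _ _ phi]);
    exists psi.
have [x0 phim] := profile_max phiP.
have phix0 := profile_max_admissible adm phiP phim.
have E := profile_unique phiP psiP (etrans phix0 (esym psi0))
  (profile_max_slope phiP phim) dpsi0 (expr1n _ 2).
have cphi := continuous_profile phiP.
have dF (x : R) : is_derive x 1 (fun x => x0 + x) 1.
  by have := is_deriveD (is_derive_cst x0 x 1) (is_derive_id x 1); rewrite add0r.
have F'E : (fun x => x0 + x)^`()%classic = cst 1.
  by apply/funext => x; rewrite derive1E; case: (dF x).
rewrite /mass -/phi /Rintegral; congr fine.
rewrite (@increasing_ge0_integration_by_substitutionT _ (fun x => x0 + x) (fun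
  x => phi x ^+ 2)).
- apply: eq_integral => x _; rewrite F'E.
  rewrite [X in (X%:E)%E = _](_ : _ = phi (x0 + x) ^+ 2 * 1)//.
  by rewrite mulr1 E mul1r add0r.
- by move=> x y; rewrite ltrD2l.
- by rewrite F'E; exact: cst_continuous.
- by rewrite F'E; exact: is_cvg_cst.
- by rewrite F'E; exact: is_cvg_cst.
- by move=> x; case: (dF x).
- exact: cvg_addrl_Ny.
- exact: cvg_addrl.
- move=> x; apply: (@continuous_compose _ (fun y => y ^+ 2)); first exact: cphi.
  exact: exprn_continuous.
- by move=> x; rewrite sqr_ge0.
Qed.

(** * Derivative of the mass *)

Lemma ler_mul_sqrt (R : rcfType) (x y : R) : 0 <= x -> x <= y ->
  x * Num.sqrt x <= y * Num.sqrt y.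
Proof. by move=> x0 xy; rewrite ler_pM ?sqrtr_ge0 ?ler_wsqrtr. Qed.

Definition reduced_dz (R : realType) (a3 gamma z w : R) : R :=
  - (gamma / 2 * (2 - w)) + 4 / 5 * a3 * z * (3 - 3 * w + w ^+ 2).

(** This is [3 K - z dK/dz], the numerator in [d/dz (4 z^(3/2) K^(-1/2)) = 2 z^(1/2) K^(-3/2) (3 K -
    z dK/dz)]. *)
Definition slope_numerator (R : realType) (a1 a3 gamma z w : R) : R :=
  2 * a1 - gamma * z * (2 - w) + 2 / 5 * a3 * z ^+ 2 * (3 - 3 * w + w ^+ 2).

Definition slope_density (R : realType) (a1 a3 gamma z u : R) : R :=
  (1 - u ^+ 2) * slope_numerator a1 a3 gamma z (u ^+ 2) /
  (reduced a1 a3 gamma z (u ^+ 2) * Num.sqrt (reduced a1 a3 gamma z (u ^+ 2))).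

Definition mass_slope (R : realType) (a1 a3 gamma z : R) : R :=
  2 * Num.sqrt z *
  \int[lebesgue_measure]_(u in `[0, 1]) slope_density a1 a3 gamma z u.

Lemma slope_numeratorE (R : realType) (a1 a3 gamma z w : R) :
  slope_numerator a1 a3 gamma z w =
  3 * reduced a1 a3 gamma z w - z * reduced_dz a3 gamma z w.
Proof. by rewrite /slope_numerator /reduced /reduced_dz; field. Qed.

Lemma reduced_close (R : realType) (a1 a3 gamma0 z0 eta : R) : 0 < eta ->
  exists2 e, 0 < e & forall gamma z, `|gamma - gamma0| < e -> `|z - z0| < e ->
    forall w, 0 <= w <= 1 ->
    `|reduced a1 a3 gamma z w - reduced a1 a3 gamma0 z0 w| <= eta /\
    `|slope_numerator a1 a3 gamma z w - slope_numerator a1 a3 gamma0 z0 w| <= eta.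
Proof.
move=> eta0; pose M := `|gamma0| + `|z0| + 1.
pose C := 4 * M + 6 * `|a3| * M.
have M0 : 0 < M by rewrite ltr_wpDl// addr_ge0.
have C0 : 0 < C by rewrite ltr_pwDl ?mulr_gt0// !mulr_ge0// ltW.
pose e := Num.min 1 (eta / C); exists e.
  by rewrite lt_min ltr01 divr_gt0.
move=> gamma z gammae ze w w01.
have e1 : e <= 1 by rewrite ge_min lexx.
have eC : e * C <= eta by rewrite -ler_pdivlMr// ge_min lexx orbT.
have zM : `|z| <= M.
  have := ler_normD (z - z0) z0; rewrite subrK /M; have := normr_ge0 gamma0; lra.
have dgz : `|gamma * z - gamma0 * z0| <= e * (2 * M).
  rewrite (_ : _ - _ = (gamma - gamma0) * z + gamma0 * (z - z0)); last by ring.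
  rewrite (le_trans (ler_normD _ _))// !normrM.
  have : `|gamma - gamma0| * `|z| <= e * M by rewrite ler_pM// ltW.
  have : `|gamma0| * `|z - z0| <= M * e.
    by rewrite ler_pM ?(ltW ze)// /M -addrA lerDl addr_ge0.
  by lra.
have dzz : `|z ^+ 2 - z0 ^+ 2| <= e * (2 * M).
  rewrite subr_sqr normrM ler_pM ?(ltW ze)//.
  rewrite (le_trans (ler_normD _ _))// mulr2n mulrDl mul1r lerD//.
  by rewrite /M addrAC lerDr addr_ge0.
have w2 : `|2 - w| <= 2 by rewrite ger0_norm; lra.
have w3 : `|3 - 3 * w + w ^+ 2| <= 3 by rewrite ger0_norm; nra.
(* [k = 1/2] serves for [reduced] and [k = 1] for [slope_numerator], which differ only in this
   coefficient as far as [gamma] and [z] enter. *)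
have bound k : 0 <= k <= 1 ->
    `|- (k * (gamma * z - gamma0 * z0) * (2 - w)) +
    2 / 5 * (a3 * ((z ^+ 2 - z0 ^+ 2) * (3 - 3 * w + w ^+ 2)))| <= eta.
  move=> /andP[k0 k1].
  apply: le_trans eC; rewrite (le_trans (ler_normD _ _))// /C [leRHS]mulrDr lerD//.
    rewrite normrN !normrM (ger0_norm k0).
    have h1 : k * `|gamma * z - gamma0 * z0| <= e * (2 * M).
      by apply: le_trans dgz; rewrite ler_piMl.
    have := ler_pM (mulr_ge0 k0 (normr_ge0 _)) (normr_ge0 _) h1 w2; lra.
  rewrite normrM ger0_norm// !normrM.
  have h := ler_pM (normr_ge0 _) (normr_ge0 _) dzz w3.
  have := ler_wpM2l (normr_ge0 a3) h; have := normr_ge0 a3.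
  have : 0 <= `|a3| * (`|z ^+ 2 - z0 ^+ 2| * `|3 - 3 * w + w ^+ 2|).
    by rewrite !mulr_ge0.
  by lra.
split.
- rewrite [X in `|X|](_ : _ = - (2^-1 * (gamma * z - gamma0 * z0) * (2 - w)) +
    2 / 5 * (a3 * ((z ^+ 2 - z0 ^+ 2) * (3 - 3 * w + w ^+ 2)))).
    by apply: bound; rewrite invr_ge0 invf_le1 ?ler0n ?ler1n.
  by rewrite /reduced; field.
- rewrite [X in `|X|](_ : _ = - (1 * (gamma * z - gamma0 * z0) * (2 - w)) +
    2 / 5 * (a3 * ((z ^+ 2 - z0 ^+ 2) * (3 - 3 * w + w ^+ 2)))).
    by apply: bound; rewrite ler01 lexx.
  by rewrite /slope_numerator; ring.
Qed.

(** The bound [m], uniform in [gamma], [z] and [w], later dominates the derivative under the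
    integral sign. *)
Lemma admissible_open (R : realType) (a1 a3 gamma0 z0 : R) :
  admissible a1 a3 gamma0 z0 ->
  exists e m, [/\ 0 < e, 0 < m & forall gamma z, `|gamma - gamma0| < e ->
    `|z - z0| < e -> admissible a1 a3 gamma z /\
    forall w, 0 <= w <= 1 -> m <= reduced a1 a3 gamma z w].
Proof.
move=> adm; have [m [M [m0 mK]]] := reduced_bounds adm; have z00 := adm.1.
have m20 : 0 < m / 2 by rewrite divr_gt0.
have [e e0 close] := reduced_close a1 a3 gamma0 z0 m20.
exists (Num.min e z0), (m / 2); split => //; first by rewrite lt_min e0.
move=> gamma z; rewrite !lt_min => /andP[ge _] /andP[ze zz0].
have Km w : 0 <= w <= 1 -> m / 2 <= reduced a1 a3 gamma z w.
  move=> w01; have [+ _] := close _ _ ge ze w w01; rewrite ler_norml.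
  by have /andP[+ _] := mK w w01; lra.
split => //; split; last by move=> w /Km; exact: lt_le_trans.
by move: zz0; rewrite ltr_norml; lra.
Qed.

Lemma is_derive_mass_density (R : realType) (a1 a3 gamma z u : R) :
  0 < reduced a1 a3 gamma z (u ^+ 2) ->
  is_derive z 1 (fun z => mass_density a1 a3 gamma z u)
    (- ((1 - u ^+ 2) * reduced_dz a3 gamma z (u ^+ 2) /
     (2 * (reduced a1 a3 gamma z (u ^+ 2) *
      Num.sqrt (reduced a1 a3 gamma z (u ^+ 2)))))).
Proof.
move=> K0; set w := u ^+ 2.
have dK : is_derive z 1 (fun z => reduced a1 a3 gamma z w) (reduced_dz a3 gamma
  z w).
  by rewrite /reduced /reduced_dz; apply: is_derive_eq; rewrite /GRing.scale/=;
    field.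
have dS := @is_derive_compose _ _ (fun z => reduced a1 a3 gamma z w) _ _ _
  (is_derive1_sqrt K0) dK.
have s0 : 0 < Num.sqrt (reduced a1 a3 gamma z w) by rewrite sqrtr_gt0.
have sn0 : Num.sqrt (reduced a1 a3 gamma z w) != 0 by rewrite gt_eqF.
have dV := @is_deriveV _ (fun z => Num.sqrt (reduced a1 a3 gamma z w)) _ _ _ sn0 dS.
apply: is_derive_eq (is_derive_scale (1 - u ^+ 2) dV) _.
rewrite /GRing.scale/= -/w -{3}(sqr_sqrtr (ltW K0)).
by field.
Qed.

Lemma continuous_reduced_sqr (R : realType) (a1 a3 gamma z : R) :
  continuous (fun u : R => reduced a1 a3 gamma z (u ^+ 2)).
Proof.
move=> u; apply: (@continuous_compose _ (reduced a1 a3 gamma z) (fun u => u ^+ 2)).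
  exact: exprn_continuous.
exact: continuous_reduced.
Qed.

Lemma continuous_slope_numerator_sqr (R : realType) (a1 a3 gamma z : R) :
  continuous (fun u : R => slope_numerator a1 a3 gamma z (u ^+ 2)).
Proof.
move=> u; apply: (@continuous_compose _ (slope_numerator a1 a3 gamma z) (fun u
  => u ^+ 2)).
  exact: exprn_continuous.
have dP (w : R) : is_derive w 1 (slope_numerator a1 a3 gamma z)
    (gamma * z + 2 / 5 * a3 * z ^+ 2 * (2 * w - 3)).
  by rewrite /slope_numerator; apply: is_derive_eq; rewrite /GRing.scale/=; field.
exact: is_derive_continuous (dP _).
Qed.

Lemma slope_density_integrable (R : realType) (a1 a3 gamma z : R) :
  admissible a1 a3 gamma z ->
  (@lebesgue_measure R).-integrable `[0, 1]
    (EFin \o slope_density a1 a3 gamma z).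
Proof.
move=> adm; apply: continuous_integrable_itv; apply: continuous_in_subspaceT => u.
rewrite inE/= in_itv/= => /sqr_in01 u01.
have K0 : 0 < reduced a1 a3 gamma z (u ^+ 2) by case: adm => _; apply.
apply: cvgM; first apply: cvgM.
- by apply: cvgB; [exact: cvg_cst|exact: exprn_continuous].
- exact: continuous_slope_numerator_sqr.
- apply: cvgV; first by rewrite gt_eqF// mulr_gt0// sqrtr_gt0.
  apply: cvgM; first exact: continuous_reduced_sqr.
  apply: (@continuous_compose _ Num.sqrt (fun u => reduced a1 a3 gamma z (u ^+ 2))).
    exact: continuous_reduced_sqr.
  exact: sqrt_continuous.
Qed.

Lemma is_derive_mass_integral (R : realType) (a1 a3 gamma z : R) :
  admissible a1 a3 gamma z ->
  is_derive z 1 (mass_integral a1 a3 gamma) (mass_slope a1 a3 gamma z).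
Proof.
move=> adm; have [e [m [e0 m0 near_adm]]] := admissible_open adm.
have z0 := adm.1.
pose I := `]z - e, z + e[%classic.
have Iz : I z by rewrite /I/= in_itv/= ltrBlDr ltrDl e0.
have Iadm x : I x -> admissible a1 a3 gamma x /\
    forall w, 0 <= w <= 1 -> m <= reduced a1 a3 gamma x w.
  rewrite /I/= in_itv/= => xI; apply: near_adm; first by rewrite subrr normr0.
  by rewrite ltr_norml; lra.
pose f := mass_density a1 a3 gamma.
have df x u : I x -> `[0%R, 1%R]%classic u -> is_derive x 1 (f^~ u)
    (- ((1 - u ^+ 2) * reduced_dz a3 gamma x (u ^+ 2) /
     (2 * (reduced a1 a3 gamma x (u ^+ 2) *
      Num.sqrt (reduced a1 a3 gamma x (u ^+ 2)))))).
  move=> /Iadm[[_ Kx] _]; rewrite /= in_itv/= => /sqr_in01 u01.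
  by apply: is_derive_mass_density; apply: Kx.
(* The numerator bounds [|dK/dz|] for [0 < x <= z + e], using [0 <= 3 - 3 w + w^2 <= 3]; the
   denominator comes from [K >= m]. *)
pose C := (`|gamma| + 12 / 5 * `|a3| * (z + e)) / (2 * (m * Num.sqrt m)).
have sm0 : 0 < Num.sqrt m by rewrite sqrtr_gt0.
have C0 : 0 <= C.
  by rewrite divr_ge0 ?addr_ge0 ?mulr_ge0 ?addr_ge0// ltW.
have d1E x u : I x -> `[0%R, 1%R]%classic u -> partial1of2 f x u =
    - ((1 - u ^+ 2) * reduced_dz a3 gamma x (u ^+ 2) /
     (2 * (reduced a1 a3 gamma x (u ^+ 2) *
      Num.sqrt (reduced a1 a3 gamma x (u ^+ 2))))).
  by move=> Ix u01; rewrite partial1of2E; have [_ ->] := df _ _ Ix u01.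
have boundC x u : I x -> `[0%R, 1%R]%classic u -> `|partial1of2 f x u| <= cst C u.
  move=> Ix u01; rewrite d1E// normrN normrM /C ler_pM//.
    have /andP[w0 w1] : 0 <= u ^+ 2 <= 1 by apply: sqr_in01; move: u01;
      rewrite /= in_itv.
    rewrite normrM -[leRHS]mul1r ler_pM//; first by rewrite ger0_norm; lra.
    rewrite /reduced_dz (le_trans (ler_normD _ _))// normrN lerD//.
      by rewrite -mulrA normrM ler_piMr// ger0_norm; lra.
    have x0 : 0 < x by have [[]] := Iadm x Ix.
    have xe : x <= z + e by move: Ix; rewrite /I/= in_itv/= => /andP[_ /ltW].
    rewrite [X in `|X|](_ : _ =
      a3 * (4 / 5 * x * (3 - 3 * u ^+ 2 + u ^+ 2 ^+ 2))); last by ring.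
    rewrite [leRHS](_ : _ = `|a3| * (12 / 5 * (z + e))); last by ring.
    have /andP[Q0 Q3] : 0 <= 3 - 3 * u ^+ 2 + u ^+ 2 ^+ 2 <= 3.
      by move: (u ^+ 2) w0 w1 => w w0 w1; nra.
    have h1 := ler_pM (ltW x0) Q0 xe Q3; have h2 := mulr_ge0 (ltW x0) Q0.
    rewrite normrM ler_wpM2l// -mulrA.
    by move: h1 h2; move: (x * _) => q h1 h2; rewrite ger0_norm; lra.
  rewrite ger0_norm ?invr_ge0; last first.
    by rewrite !mulr_ge0 ?sqrtr_ge0// ltW//; apply: (Iadm x Ix).1.2;
      apply: sqr_in01; move: u01; rewrite /= in_itv.
  have mK : m <= reduced a1 a3 gamma x (u ^+ 2).
    by apply: (Iadm x Ix).2; apply: sqr_in01; move: u01; rewrite /= in_itv.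
  have K0 := lt_le_trans m0 mK.
  rewrite lef_pV2 ?posrE ?mulr_gt0 ?sqrtr_gt0// ler_pM2l//.
  exact: ler_mul_sqrt (ltW m0) mK.
have intf x : I x -> (@lebesgue_measure R).-integrable `[0, 1] (EFin \o f x).
  by move=> /Iadm[admx _]; exact: mass_density_integrable.
have intC : (@lebesgue_measure R).-integrable `[0, 1] (EFin \o cst C).
  by apply: continuous_integrable_itv; apply: continuous_subspaceT;
    exact: cst_continuous.
have derf x u : I x -> `[0%R, 1%R]%classic u -> derivable (f^~ u) x 1.
  by move=> Ix u01; case: (df _ _ Ix u01).
have m01 : measurable (`[0%R, 1%R]%classic : set (measurableTypeR R)) by [].
have C0' (u : R) : 0 <= cst C u by [].
have dF := derivable_under_integral m01 Iz intf derf C0' intC boundC.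
have F'E := differentiation_under_integral m01 Iz intf derf C0' intC boundC.
set F := (fun x' : R => _) in dF F'E.
have DF := is_derive_derive1 dF.
have dzz : is_derive z 1 (fun z => z * Num.sqrt z) (3 / 2 * Num.sqrt z).
  have ds := is_derive1_sqrt z0.
  apply: is_derive_eq; rewrite /GRing.scale/= -{1}(sqr_sqrtr (ltW z0)).
  by field; rewrite gt_eqF// sqrtr_gt0.
have -> : mass_integral a1 a3 gamma = (fun z => 4 * ((z * Num.sqrt z) * F z)).
  by apply/funext => x; rewrite /mass_integral /F /f; ring.
have dM : is_derive z 1 (fun z => (z * Num.sqrt z) * F z)
   (3 / 2 * Num.sqrt z * F z + z * Num.sqrt z * F^`()%classic z).
  by apply: is_derive_eq (is_deriveM dzz DF) _; rewrite /GRing.scale/=; ring.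
apply: is_derive_eq (is_derive_scale 4 dM) _.
have intS := slope_density_integrable adm; have intF := intf z Iz.
have int3F : (@lebesgue_measure R).-integrable `[0, 1] (EFin \o (fun u => 3 * f
  z u)).
  exact: integrable_scale.
(* Substituting [dK/dz = (3 K - N) / z], with [N] the numerator, turns [F'] into the integral of the
   slope density minus [3 F], over [2 z]; the terms in [F] then cancel. *)
rewrite F'E [X in z * Num.sqrt z * X](_ : _ = (2 * z)^-1 *
  (\int[@lebesgue_measure R]_(u in `[0, 1]) slope_density a1 a3 gamma z u - 3 *
    F z)).
  by rewrite /mass_slope; field; rewrite gt_eqF.
rewrite /F -RintegralZl// -RintegralB// -RintegralZl//; last exact: integrable_subr.
apply: eq_Rintegral => u; rewrite inE => u01; rewrite -/(partial1of2 f z u) d1E//.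
rewrite /slope_density slope_numeratorE /f /mass_density.
have K0 : 0 < reduced a1 a3 gamma z (u ^+ 2).
  by apply: adm.2; apply: sqr_in01; move: u01; rewrite /= in_itv.
have : 0 < Num.sqrt (reduced a1 a3 gamma z (u ^+ 2)) by rewrite sqrtr_gt0.
by move=> sK0; field; rewrite !gt_eqF.
Qed.

Lemma is_derive_potential_reduced (R : realType) (a1 a3 gamma z : R) :
  is_derive z 1 (potential a1 a3 gamma) (reduced a1 a3 gamma z 0).
Proof.
apply: is_derive_eq (is_derive_potential a1 a3 gamma z) _.
by rewrite /reduced; field.
Qed.

(** An admissible [z'] satisfies [W < W(z')] at every smaller positive point, so [omega] and [gamma]
    determine the admissible [z]. *)
Lemma potential_inj (R : realType) (a1 a3 gamma z z' : R) :
  admissible a1 a3 gamma z -> admissible a1 a3 gamma z' ->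
  potential a1 a3 gamma z = potential a1 a3 gamma z' -> z = z'.
Proof.
wlog zz' : z z' / z < z'.
  move=> h admz admz' E; have [zz'|zz'|//] := ltgtP z z'; first exact: h.
  by apply/esym/h.
move=> [z0 _] [z'0 Kz'] E.
have := potentialB a1 a3 gamma z' (1 - z / z').
have -> : z' * (1 - (1 - z / z')) = z by field; rewrite gt_eqF.
have w01 : 0 < 1 - z / z' <= 1.
  by rewrite subr_gt0 ltr_pdivrMr// mul1r zz' gerBl divr_ge0 ?ltW.
have Kw : 0 < reduced a1 a3 gamma z' (1 - z / z').
  by apply: Kz'; case/andP: w01 => /ltW -> ->.
move/eqP; rewrite E subrr eq_sym !mulf_eq0 (gt_eqF z'0) (gt_eqF Kw) orbF/=.
by case/andP: w01 => /gt_eqF ->.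
Qed.

(** Chain rule: the mass is known as a function of [z], and [z] depends on [omega] through the local
    inverse of [W], whose derivative is [1 / W'(z) = 1 / K(z, 0)]. *)
Lemma JE (R : realType) (a1 a3 gamma z : R) : admissible a1 a3 gamma z ->
  J a1 a3 (potential a1 a3 gamma z, gamma) =
  mass_slope a1 a3 gamma z / reduced a1 a3 gamma z 0.
Proof.
move=> adm; have [e [m [e0 m0 near_adm]]] := admissible_open adm.
have adm' x : `|x - z| < e -> admissible a1 a3 gamma x.
  by move=> xz; apply: (near_adm gamma x _ xz).1; rewrite subrr normr0.
pose W := potential a1 a3 gamma.
(* Local inverse of [W]; the default value [z] only occurs for values not attained within distance
   [e]. *)
pose g w := xget z [set x | `|x - z| < e /\ W x = w].
have near_z : \forall x \near z, `|x - z| < e.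
  by near=> x; rewrite distrC; near: x; exact: nbhsx_ballx.
have gK x : `|x - z| < e -> g (W x) = x.
  move=> xz; rewrite /g; case: xgetP => [y _ [yz Wy]|/(_ x)]; last by case.
  exact: (potential_inj (adm' _ yz) (adm' _ xz) Wy).
have gnearK : {near z, cancel W g} by near=> x; apply: gK; near: x.
have Wnear : {near z, continuous W} by near=> x; exact: continuous_potential.
have K0 : 0 < reduced a1 a3 gamma z 0 by apply: adm.2; rewrite lexx ler01.
have dg : is_derive (W z) 1 g (reduced a1 a3 gamma z 0)^-1.
  apply: is_derive_inverse gnearK Wnear (is_derive_potential_reduced _ _ _ _) _.
  by rewrite gt_eqF.
have gz : g (W z) = z by apply: gK; rewrite subrr normr0.
have gsym := near_continuous_can_sym Wnear gnearK.
(* The derivative sees a whole neighbourhood of [W z], so the formula is needed for all nearby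
   [omega]; [gsym] says that these are attained. *)
have massg : \forall w \near W z, mass_integral a1 a3 gamma (g w) = mass a1 a3
  w gamma.
  have cg := is_derive_continuous dg.
  near=> w.
  have gw : W (g w) = w by near: w; exact: gsym.
  rewrite -[in RHS]gw massE//; apply: adm'; rewrite distrC -{1}gz.
  by near: w; move/cvgrPdist_lt : cg; exact.
rewrite /J /=.
have dN := is_derive_mass_integral adm; rewrite -{1}gz in dN.
have [_] := near_eq_is_derive massg (is_derive_compose dN dg).
by rewrite derive1E.
Unshelve. all: by end_near. Qed.

Lemma Rintegral_ge_step (R : realType) (f : R -> R) (a b B L : R) :
  0 <= a -> a <= b -> b <= 1 -> 
  (@lebesgue_measure R).-integrable `[0, 1] (EFin \o f) ->
  (forall u, 0 <= u <= 1 -> - B <= f u) ->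
  (forall u, a <= u <= b -> L - B <= f u) ->
  L * (b - a) - B <= \int[@lebesgue_measure R]_(u in `[0, 1]) f u.
Proof.
move=> a0 ab b1 intf fB fL.
have m01 : measurable (`[0%R, 1%R]%classic : set (measurableTypeR R)) by [].
pose ind : R -> R := \1_`[a, b]%classic.
have inti : (@lebesgue_measure R).-integrable `[0, 1] (EFin \o ind).
  by apply: integrableS (integrable_indic_itv a b true false).
have intLi : (@lebesgue_measure R).-integrable `[0, 1] (EFin \o (fun u => L *
  ind u)).
  exact: integrable_scale.
have intB : (@lebesgue_measure R).-integrable `[0, 1] (EFin \o cst B).
  by apply: continuous_integrable_itv; apply: continuous_subspaceT;
    exact: cst_continuous.
have mu_itv (x y : R) : x <= y ->
    fine (@lebesgue_measure R `[x, y]%classic) = y - x.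
  move=> xy; have := @lebesgue_measure_itv R `[x, y]; rewrite /= lte_fin => ->.
  by move: xy; rewrite le_eqVlt => /orP[/eqP ->|->]; rewrite ?ltxx ?subrr// -EFinB.
have Iind : \int[@lebesgue_measure R]_(u in `[0, 1]) ind u = b - a.
  rewrite /Rintegral /ind integral_indic//.
  rewrite (_ : _ `&` _ = `[a, b]%classic); last first.
    apply/seteqP; split=> [u [//]|u /=].
    rewrite !in_itv/= => /andP[au ub]; split; rewrite ?au ?ub//.
    by rewrite (le_trans a0 au) (le_trans ub b1).
  exact: (mu_itv _ _ ab).
have -> : L * (b - a) - B = \int[@lebesgue_measure R]_(u in `[0, 1]) (L * ind u
  - cst B u).
  rewrite RintegralB// RintegralZl// Rintegral_cst// Iind.
  by rewrite (mu_itv _ _ (@ler01 R)) subr0 mulr1.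
apply: le_Rintegral => //; first exact: integrable_subr.
move=> u; rewrite /= in_itv/= => u01; rewrite /ind indicE.
have [|] := boolP (u \in _) => /=; last by rewrite mulr0 sub0r fB.
by rewrite inE /= in_itv/= mulr1 => /fL.
Qed.

(** * Blow-up of the derivative of the mass *)

(* The integrand is bounded below outside the [rho]-neighbourhood of the zero
   [ustar] of [reduced gamma0 z0 (u ^ 2)] and is at least of order [rho ^ -3]
   in it. *)
Lemma slope_integral_blowup (R : realType) (a1 a3 gamma0 z0 ustar b C kappa p0
  : R) :
  b ^+ 2 = 1 -> 0 <= ustar < 1 -> 0 < C -> 0 < kappa -> 0 < p0 ->
  (forall u, 0 <= u <= 1 ->
    reduced a1 a3 gamma0 z0 (u ^+ 2) <= C * (u - ustar) ^+ 2) ->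
  (forall u, 0 <= u <= 1 -> reduced a1 a3 gamma0 z0 (u ^+ 2) < kappa ->
    p0 <= b * slope_numerator a1 a3 gamma0 z0 (u ^+ 2)) ->
  forall A, exists2 e, 0 < e & forall gamma z, `|gamma - gamma0| < e ->
    `|z - z0| < e -> admissible a1 a3 gamma z ->
    A <= b * \int[lebesgue_measure]_(u in `[0, 1]) slope_density a1 a3 gamma z u.
Proof.
move=> bb /andP[us0 us1] C0 kappa0 p00 K0C P0p A.
have cP := @continuous_slope_numerator_sqr _ a1 a3 gamma0 z0.
have nb : `|b| = 1.
  by apply/eqP; rewrite -(@pexpr_eq1 _ _ 2)// -normrX bb normr1.
have [PM PM0 PP] : exists2 PM, 0 <= PM & forall u, 0 <= u <= 1 ->
    `|slope_numerator a1 a3 gamma0 z0 (u ^+ 2)| <= PM.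
  have [|x _ xmax] := EVT_max (@ler01 R) (f :=
    fun u => `|slope_numerator a1 a3 gamma0 z0 (u ^+ 2)|).
    by apply: continuous_subspaceT => u; apply: cvg_norm; exact: cP.
  by exists `|slope_numerator a1 a3 gamma0 z0 (x ^+ 2)| => // u u01;
    apply: xmax; rewrite in_itv.
pose k2 := kappa / 2.
have k20 : 0 < k2 by rewrite divr_gt0.
(* Bounds the integrand where [K >= k2]; where [K] is smaller, the sign of the numerator makes [b]
   times the integrand nonnegative, so [- B] is a lower bound everywhere. *)
pose B := (PM + p0 / 2) / (k2 * Num.sqrt k2).
have B0 : 0 <= B.
  by rewrite divr_ge0 ?addr_ge0 ?mulr_ge0 ?sqrtr_ge0// ltW.
(* Up to [mid] the factor [1 - u^2] is at least [c > 0]. Only points to the right of [ustar] are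
   used, since [ustar] may be 0. *)
pose mid := (1 + ustar) / 2.
have mid1 : mid < 1 by rewrite /mid; lra.
have mid0 : 0 <= mid by rewrite /mid; lra.
pose c := 1 - mid ^+ 2.
have c0 : 0 < c by rewrite /c; nra.
have s2C : 0 < Num.sqrt (2 * C) by rewrite sqrtr_gt0 mulr_gt0.
pose Q := c * (p0 / 2) / (2 * C * Num.sqrt (2 * C)).
have Q0 : 0 < Q by rewrite divr_gt0 ?mulr_gt0 ?divr_gt0.
pose D := `|A| + B + 1.
have D0 : 0 < D by rewrite ltr_wpDl// addr_ge0.
(* [rho <= 1] and [rho <= Q / D] give [Q / rho^2 >= D]; [rho <= k2 / (4 C)] gives [d < k2];
   [rho <= mid - ustar] keeps the interval within [[ustar, mid]]. *)
pose rho := Num.min (Num.min 1 (mid - ustar)) (Num.min (Q / D) (k2 / (4 * C))).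
have rho0 : 0 < rho.
  rewrite !lt_min ltr01 !divr_gt0 ?mulr_gt0//= andbT subr_gt0 /mid; lra.
have [rho1 rhom rhoQ rhok] : [/\ rho <= 1, rho <= mid - ustar, rho <= Q / D &
  rho <= k2 / (4 * C)].
  by split; rewrite !ge_min lexx ?orbT.
clearbody rho.
(* One [C rho^2] bounds the limiting [K] on the interval, the other is left for the perturbation
   [eta]. *)
pose d := 2 * C * rho ^+ 2.
have d0 : 0 < d by rewrite !mulr_gt0// exprn_gt0.
have rr : rho ^+ 2 <= rho by rewrite expr2 ler_piMl// ltW.
have dk : d < k2.
  move: rhok; rewrite ler_pdivlMr ?mulr_gt0// => h.
  have : C * rho ^+ 2 <= C * rho by rewrite ler_pM2l.
  by rewrite /d; nra.
pose eta := Num.min (Num.min k2 (p0 / 2)) (C * rho ^+ 2).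
have eta0 : 0 < eta by rewrite !lt_min k20 divr_gt0//= mulr_gt0// exprn_gt0.
have [etak etap etar] : [/\ eta <= k2, eta <= p0 / 2 & eta <= C * rho ^+ 2].
  by split; rewrite !ge_min lexx ?orbT.
clearbody eta.
have [e e0 close] := reduced_close a1 a3 gamma0 z0 eta0.
exists e => // gamma z ge ze adm.
pose K u := reduced a1 a3 gamma z (u ^+ 2).
pose P u := slope_numerator a1 a3 gamma z (u ^+ 2).
have K_gt0 u : 0 <= u <= 1 -> 0 < K u by move=> u01; apply: adm.2; exact: sqr_in01.
have Psmall u : 0 <= u <= 1 -> K u < k2 -> p0 / 2 <= b * P u.
  move=> u01 Ku; have [hK hP] := close _ _ ge ze _ (sqr_in01 u01).
  have hb : `|b * P u - b * slope_numerator a1 a3 gamma0 z0 (u ^+ 2)| <= eta.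
    by rewrite -mulrBr normrM nb mul1r.
  have := P0p u u01; move: hb hK; rewrite !ler_norml => /andP[hb _] /andP[hK _].
  have lek : reduced a1 a3 gamma0 z0 (u ^+ 2) < kappa.
    by move: Ku etak hK; rewrite /K /k2; clear; lra.
  by move=> /(_ lek); move: hb etap; clear; lra.
have densE u : b * slope_density a1 a3 gamma z u =
    (1 - u ^+ 2) * (b * P u) / (K u * Num.sqrt (K u)).
  by rewrite /slope_density -/(P u) -/(K u); ring.
have KsK u : 0 <= u <= 1 -> 0 < K u * Num.sqrt (K u).
  by move=> /K_gt0 Ku; rewrite mulr_gt0// sqrtr_gt0.
have lowB u : 0 <= u <= 1 -> - B <= b * slope_density a1 a3 gamma z u.
  move=> u01; rewrite densE; have /andP[w0 w1] := sqr_in01 u01.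
  have [kK|Kk] := leP k2 (K u); last first.
    rewrite (@le_trans _ _ 0) ?oppr_le0// divr_ge0 ?(ltW (KsK _ u01))//.
    rewrite mulr_ge0 ?subr_ge0// (le_trans _ (Psmall _ u01 Kk))//.
    by rewrite divr_ge0// ltW.
  rewrite lerNl (le_trans (ler_norm _))// normrN normf_div /B.
  rewrite (gtr0_norm (KsK _ u01)) ler_pM ?invr_ge0 ?(ltW (KsK _ u01))//.
    rewrite normrM -[leRHS]mul1r ler_pM//; first by clear -w0 w1;
      rewrite ger0_norm; lra.
    rewrite normrM nb mul1r.
    have [_ hP] := close _ _ ge ze _ (sqr_in01 u01).
    have := ler_normD (P u - slope_numerator a1 a3 gamma0 z0 (u ^+ 2))
      (slope_numerator a1 a3 gamma0 z0 (u ^+ 2)); rewrite subrK.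
    by have := PP u u01; move: hP etap; rewrite /P; clear; lra.
  rewrite lef_pV2 ?posrE ?KsK// ?mulr_gt0 ?sqrtr_gt0//.
  exact: ler_mul_sqrt (ltW k20) kK.
(* Equal to [Q / rho^3], so that an interval of length [rho] contributes [Q / rho^2]. *)
pose L := c * (p0 / 2) / (d * Num.sqrt d).
have lowL u : ustar <= u <= ustar + rho -> L - B <= b * slope_density a1 a3
  gamma z u.
  move=> /andP[uu ur].
  have u01 : 0 <= u <= 1.
    by clear -us0 uu ur rhom mid1; apply/andP; split; lra.
  have um : u <= mid by clear -ur rhom; lra.
  have Kd : K u <= d.
    have [hK _] := close _ _ ge ze _ (sqr_in01 u01); move: hK;
      rewrite ler_norml => /andP[_ hK].
    have : (u - ustar) ^+ 2 <= rho ^+ 2.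
      by clear -uu ur rho0; rewrite ler_pXn2r ?nnegrE//; lra.
    rewrite -(ler_pM2l C0) => h; have := K0C u u01.
    by move: hK h etar; rewrite /K /d; clear; lra.
  have Pp := Psmall u u01 (le_lt_trans Kd dk).
  rewrite (@le_trans _ _ L) ?gerBl// densE /L.
  have cu : c <= 1 - u ^+ 2.
    by clear -us0 uu um mid0; rewrite /c lerD2l lerN2 ler_pXn2r ?nnegrE//; lra.
  apply: ler_pM.
  - by rewrite mulr_ge0 ?divr_ge0 ?(ltW c0) ?(ltW p00).
  - by rewrite invr_ge0 mulr_ge0 ?sqrtr_ge0 ?(ltW d0).
  - by apply: ler_pM => //; rewrite ?divr_ge0 ?(ltW c0) ?(ltW p00).
  - rewrite lef_pV2 ?posrE ?KsK// ?mulr_gt0 ?sqrtr_gt0//.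
    exact: ler_mul_sqrt (ltW (K_gt0 _ u01)) Kd.
have usr : ustar + rho <= 1 by clear -rhom mid1; lra.
have intS := slope_density_integrable adm.
have m01 : measurable (`[0%R, 1%R]%classic : set (measurableTypeR R)) by [].
have intbS : (@lebesgue_measure R).-integrable `[0, 1]
    (EFin \o (fun u => b * slope_density a1 a3 gamma z u)).
  exact: integrable_scale.
rewrite -RintegralZl//.
apply: le_trans (Rintegral_ge_step us0 _ usr intbS lowB lowL);
  last by rewrite lerDl ltW.
rewrite [ustar + rho]addrC addrK lerBrDr.
have LrE : L * rho = Q / rho ^+ 2.
  rewrite /L /Q /d sqrtrM ?mulr_ge0 ?ltW// sqrtr_sqr gtr0_norm//.
  by field; rewrite !gt_eqF.
have : D <= Q / rho ^+ 2.
  rewrite ler_pdivlMr ?exprn_gt0//; move: rhoQ; rewrite ler_pdivlMr// => h.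
  by rewrite mulrC; apply: le_trans h; rewrite ler_pM2r.
by rewrite LrE /D; have := ler_norm A; clear; lra.
Qed.

(** [J] is [2 sqrt z] times the integral, divided by [K(z, 0)]. Near [z0] the first factor is
    bounded below and [K(z, 0)] above, so the divergence passes to [J]; the sign [b] covers both
    limits. *)
Lemma J_blowup (R : realType) (a1 a3 gamma0 z0 ustar b C kappa p0 : R) :
  0 < z0 -> b ^+ 2 = 1 -> 0 <= ustar < 1 -> 0 < C -> 0 < kappa -> 0 < p0 ->
  (forall u, 0 <= u <= 1 ->
    reduced a1 a3 gamma0 z0 (u ^+ 2) <= C * (u - ustar) ^+ 2) ->
  (forall u, 0 <= u <= 1 -> reduced a1 a3 gamma0 z0 (u ^+ 2) < kappa ->
    p0 <= b * slope_numerator a1 a3 gamma0 z0 (u ^+ 2)) ->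
  forall A, exists2 e, 0 < e & forall gamma z, `|gamma - gamma0| < e ->
    `|z - z0| < e -> admissible a1 a3 gamma z ->
    A <= b * J a1 a3 (potential a1 a3 gamma z, gamma).
Proof.
move=> z00 bb us01 C0 kappa0 p00 K0C P0p A.
have [e1 e10 close] := reduced_close a1 a3 gamma0 z0 (@ltr01 R).
pose k := `|reduced a1 a3 gamma0 z0 0| + 1.
have k0 : 0 < k by rewrite ltr_wpDl.
pose s := Num.sqrt (z0 / 2).
have s0 : 0 < s by rewrite sqrtr_gt0 divr_gt0.
have [e2 e20 blow] := slope_integral_blowup bb us01 C0 kappa0 p00 K0C P0p (`|A|
  * k / (2 * s)).
exists (Num.min (Num.min e1 e2) (z0 / 2)).
  by rewrite !lt_min e10 e20 divr_gt0.
move=> gamma z; rewrite !lt_min => /andP[/andP[g1 g2] _] /andP[/andP[z1 z2]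
  zz0] adm.
rewrite JE// /mass_slope.
have K0 : 0 < reduced a1 a3 gamma z 0 by apply: adm.2; rewrite lexx ler01.
have Kk : reduced a1 a3 gamma z 0 <= k.
  have := close _ _ g1 z1 0; rewrite lexx ler01 => /(_ isT)[+ _].
  by rewrite ler_norml /k; have := ler_norm (reduced a1 a3 gamma0 z0 0); lra.
have sz : s <= Num.sqrt z.
  by apply: ler_wsqrtr; move: zz0; rewrite ltr_norml; lra.
rewrite mulrA ler_pdivlMr// (le_trans (ler_wpM2r (ltW K0) (ler_norm A)))//.
rewrite (@le_trans _ _ (`|A| * k)) ?ler_wpM2l//.
have := blow _ _ g2 z2 adm; move: (Rintegral _ _ _) => I Ib.
have I0 : 0 <= b * I.
  by apply: le_trans Ib; rewrite divr_ge0 ?mulr_ge0 ?(ltW k0) ?(ltW s0).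
move: Ib; rewrite ler_pdivrMr ?mulr_gt0// => /le_trans; apply.
rewrite [leRHS](_ : _ = b * I * (2 * Num.sqrt z)); last by ring.
by apply: ler_wpM2l => //; rewrite ler_pM2l.
Qed.

(** * Parameters close to the boundary *)

Lemma R_ex_admissible (R : realType) (a1 a3 gamma z : R) :
  admissible a1 a3 gamma z -> R_ex a1 a3 (potential a1 a3 gamma z, gamma).
Proof.
move=> adm; split; first exact: admissible_potential_gt0.
by have [psi psiP _] := profile_exists adm; exists psi.
Qed.

Lemma admissibleP (R : realType) (a1 a3 gamma z : R) : 0 < z ->
  0 < reduced a1 a3 gamma z 0 ->
  (forall s, 0 <= s < z ->
    0 < potential a1 a3 gamma z - potential a1 a3 gamma s) ->
  admissible a1 a3 gamma z.
Proof.
move=> z0 K0 Ws; split => // w /andP[]; rewrite le_eqVlt => /orP[/eqP <-//|w0 w1].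
have : 0 < z * w * reduced a1 a3 gamma z w.
  rewrite -potentialB; apply: Ws; rewrite mulr_ge0 ?subr_ge0 ?(ltW z0)//=.
  by rewrite gtr_pMr// ltrBlDr ltrDl.
by rewrite pmulr_rgt0// mulr_gt0.
Qed.

Lemma potential_close (R : realType) (a1 a3 omega0 gamma0 M eta : R) :
  0 < eta -> exists2 d, 0 < d & forall omega gamma s,
    `|omega - omega0| < d -> `|gamma - gamma0| < d -> 0 <= s <= M ->
    `|(omega - potential a1 a3 gamma s) - (omega0 - potential a1 a3 gamma0 s)|
      < eta.
Proof.
move=> eta0; pose C := 1 + M ^+ 2.
have C0 : 0 < C by rewrite ltr_pwDl// sqr_ge0.
have C20 : 0 < 2 * C by rewrite mulr_gt0.
exists (eta / (2 * C)); first by rewrite divr_gt0.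
move=> omega gamma s; rewrite !ltr_pdivlMr// => od gd /andP[s0 sM].
have ss : 0 <= s ^+ 2 <= M ^+ 2.
  by rewrite sqr_ge0/= ler_pXn2r ?nnegrE ?(le_trans s0).
rewrite (_ : _ - _ = (omega - omega0) + (gamma - gamma0) * (s ^+ 2 / 2));
  last first.
  by rewrite /potential; field.
rewrite (le_lt_trans (ler_normD _ _))// normrM (ger0_norm (x := s ^+ 2 / 2));
  last first.
  by rewrite divr_ge0 ?sqr_ge0.
have g2 : `|gamma - gamma0| * (s ^+ 2 / 2) <= `|gamma - gamma0| * (M ^+ 2 / 2).
  by rewrite ler_wpM2l// ler_pM2r ?invr_gt0//; case/andP: ss.
move: od gd; rewrite /C ![2 * (1 + _)]mulrDr ![_ * (2 * 1 + _)]mulrDr => od gd.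
have : 0 <= `|omega - omega0| * M ^+ 2 by rewrite mulr_ge0 ?sqr_ge0.
have : 0 <= `|gamma - gamma0| by [].
have : 0 <= `|omega - omega0| by [].
by move: g2 od gd; move: `|omega - omega0| `|gamma - gamma0| => x y; lra.
Qed.

Lemma potential_gap (R : realType) (a1 a3 gamma z s : R) :
  admissible a1 a3 gamma z -> 0 <= s < z ->
  potential a1 a3 gamma s < potential a1 a3 gamma z.
Proof.
move=> [z0 Kz] /andP[s0 sz]; rewrite -subr_gt0.
have -> : potential a1 a3 gamma s = potential a1 a3 gamma (z * (1 - (1 - s / z))).
  by congr potential; field; rewrite gt_eqF.
have w01 : 0 < 1 - s / z <= 1.
  by rewrite subr_gt0 ltr_pdivrMr// mul1r sz gerBl divr_ge0 ?(ltW z0).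
have [w0 w1] := andP w01.
by rewrite potentialB !mulr_gt0// Kz// w1 ltW.
Qed.

Lemma potential_IVT (R : realType) (a1 a3 gamma omega lo hi : R) :
  lo <= hi -> potential a1 a3 gamma lo <= omega <= potential a1 a3 gamma hi ->
  exists2 z, lo <= z <= hi & potential a1 a3 gamma z = omega.
Proof.
move=> lohi /andP[h1 h2].
have [|z] := @IVT _ (potential a1 a3 gamma) lo hi omega lohi
   (continuous_subspaceT (@continuous_potential _ a1 a3 gamma)).
  by rewrite ge_min le_max h1 h2 orbT.
by rewrite in_itv; exists z.
Qed.

(** [W] crosses the value [omega] strictly between two points around [z0]; this survives small
    changes of both parameters, and the intermediate value theorem gives a [z] that is still
    admissible. *)
Lemma R_ex_open (R : realType) (a1 a3 gamma0 z0 : R) :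
  admissible a1 a3 gamma0 z0 -> exists2 d, 0 < d & forall omega gamma,
    `|omega - potential a1 a3 gamma0 z0| < d -> `|gamma - gamma0| < d ->
    R_ex a1 a3 (omega, gamma).
Proof.
move=> adm; have [e [m [e0 m0 near_adm]]] := admissible_open adm; have z00 := adm.1.
pose r := Num.min (e / 2) (z0 / 2).
have r0 : 0 < r by rewrite lt_min !divr_gt0.
have re : r <= e / 2 by rewrite ge_min lexx.
have rz : r <= z0 / 2 by rewrite ge_min lexx orbT.
pose lo := z0 - r; pose hi := z0 + r.
have admhi : admissible a1 a3 gamma0 hi.
  apply: (near_adm _ _ _ _).1; first by rewrite subrr normr0.
  by rewrite /hi addrAC subrr add0r gtr0_norm//; lra.
have Wlo : potential a1 a3 gamma0 lo < potential a1 a3 gamma0 z0.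
  by apply: potential_gap => //; rewrite /lo; apply/andP; split; lra.
have Whi : potential a1 a3 gamma0 z0 < potential a1 a3 gamma0 hi.
  by apply: potential_gap => //; rewrite /hi; apply/andP; split; lra.
set w0 := potential a1 a3 gamma0 z0 in Wlo Whi *.
have [d1 d10 c1] := @potential_close _ a1 a3 w0 gamma0 hi _ (etrans (subr_gt0 _
  _) Wlo).
have [d2 d20 c2] := @potential_close _ a1 a3 w0 gamma0 hi _ (etrans (subr_gt0 _
  _) Whi).
exists (Num.min (Num.min d1 d2) e); first by rewrite !lt_min d10 d20.
move=> omega gamma; rewrite !lt_min => /andP[/andP[om1 om2] _] /andP[/andP[ga1
  ga2] ga3].
have lo0 : 0 <= lo <= hi by rewrite /lo /hi; apply/andP; split; lra.
have hi0 : 0 <= hi <= hi by rewrite lexx /hi; lra.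
have [||z zlh <-] := @potential_IVT _ a1 a3 gamma omega lo hi.
- by case/andP: lo0.
- have := c1 _ _ _ om1 ga1 lo0; have := c2 _ _ _ om2 ga2 hi0.
  by rewrite !ltr_norml; lra.
apply: R_ex_admissible; apply: (near_adm _ _ ga3 _).1.
by move: zlh; rewrite /lo /hi ltr_norml; lra.
Qed.

(** * Potentials with a double root at [t] *)

Section double_root.
Context (R : realType) (a1 a3 omega0 gamma0 t A B : R).
Hypotheses (t0 : 0 < t) (a1E : a1 = 3 * t * A + 9 / 2 * B * t ^+ 2)
  (a3E : a3 = 5 / 2 * B) (gamma0E : gamma0 = 2 * A + 6 * B * t)
  (omega0E : omega0 = t ^+ 2 * (A + B * t)) (omega0_gt0 : 0 < omega0).

(** The hypotheses on [A] and [B] match the coefficients of this factorization at [gamma0]; a change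
    of [gamma] only adds a multiple of [s^2]. *)
Lemma double_rootE gamma s : omega0 - potential a1 a3 gamma s =
  (t - s) ^+ 2 * (A + B * (t - s)) - (gamma0 - gamma) / 2 * s ^+ 2.
Proof. by rewrite omega0E /potential gamma0E a1E a3E; field. Qed.

Lemma potential_gammaB gamma z s :
  potential a1 a3 gamma z - potential a1 a3 gamma s =
  (t - s) ^+ 2 * (A + B * (t - s)) - (t - z) ^+ 2 * (A + B * (t - z)) +
  (gamma0 - gamma) / 2 * (z ^+ 2 - s ^+ 2).
Proof.
rewrite [LHS](_ : _ = (omega0 - potential a1 a3 gamma s) -
  (omega0 - potential a1 a3 gamma z)); last by ring.
by rewrite !double_rootE; ring.
Qed.

Lemma reduced_gamma0 gamma z : reduced a1 a3 gamma z 0 =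
  (t - z) * (2 * A + 3 * B * (t - z)) + (gamma0 - gamma) * z.
Proof. by rewrite /reduced gamma0E a1E a3E; field. Qed.

Let q0 : 0 < A + B * t.
Proof. by move: omega0_gt0; rewrite omega0E pmulr_rgt0// exprn_gt0. Qed.

Section left.
Hypothesis A0 : 0 < A.

Let mu := Num.min A (A + B * t).

Let mu0 : 0 < mu. Proof. by rewrite lt_min A0 q0. Qed.

(** An affine function is at least the smaller of its values at the two ends, here [A] and
    [A + B t]. *)
Lemma left_factor x : 0 <= x <= t -> mu <= A + B * x.
Proof.
move=> /andP[x0 xt].
have [muA muq] : mu <= A /\ mu <= A + B * t by rewrite !ge_min !lexx orbT.
have [B0|B0] := leP 0 B.
  by rewrite (le_trans muA)// lerDl mulr_ge0.
by rewrite (le_trans muq)// lerD2l ler_nM2l.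
Qed.

(** Away from [t], [h] stays positive by closeness to a function bounded below by [r^2 mu]. At [t]
    it becomes negative, because lowering [omega] and lowering [gamma] both decrease it. The root in
    between is admissible since [W] increases there. *)
Lemma left_solve (e : R) : 0 < e -> exists2 d, 0 < d &
  forall omega gamma, omega0 - d < omega < omega0 -> gamma0 - d < gamma < gamma0 ->
  exists z, [/\ `|z - t| < e, admissible a1 a3 gamma z &
    potential a1 a3 gamma z = omega].
Proof.
move=> e0.
(* The last bound gives [2 |B| r <= A], hence [A + B x >= 0] for [0 <= x <= 2 r], from which the
   monotonicity of [W] on [[t - r, t]] follows. *)
pose r := Num.min (Num.min e (t / 2)) (A / (2 * (`|B| + 1))).
have B1 : 0 < `|B| + 1 by rewrite ltr_wpDl.
have r0 : 0 < r by rewrite !lt_min e0 !divr_gt0// mulr_gt0.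
have [re rt rA] : [/\ r <= e, r <= t / 2 & r <= A / (2 * (`|B| + 1))].
  by split; rewrite !ge_min lexx ?orbT.
clearbody r.
have rB : 2 * `|B| * r <= A.
  move: rA; rewrite ler_pdivlMr ?mulr_gt0// => rA; apply: le_trans rA.
  by rewrite mulrC ler_pM2l// ler_pM2l// lerDl.
have BrA x : 0 <= x <= 2 * r -> 0 <= A + B * x.
  move=> /andP[x0 xr]; have : `|B * x| <= A.
    rewrite normrM (ger0_norm x0); apply: le_trans rB.
    by rewrite [2 * _]mulrC -mulrA ler_wpM2l.
  by rewrite ler_norml; lra.
have eta0 : 0 < r ^+ 2 * mu by rewrite mulr_gt0// exprn_gt0.
have [d d0 close] := potential_close a1 a3 omega0 gamma0 t eta0.
exists d => // omega gamma /andP[w1 w2] /andP[g1 g2].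
have od : `|omega - omega0| < d by rewrite ltr_norml; lra.
have gd : `|gamma - gamma0| < d by rewrite ltr_norml; lra.
have Wlo s : 0 <= s <= t - r -> potential a1 a3 gamma s < omega.
  move=> /andP[s0 sr]; have st : 0 <= s <= t by apply/andP; split; lra.
  have := close _ _ _ od gd st;
    rewrite double_rootE subrr !mul0r subr0 ltr_norml => /andP[h _].
  have : r ^+ 2 * mu <= (t - s) ^+ 2 * (A + B * (t - s)).
    apply: ler_pM; rewrite ?sqr_ge0 ?(ltW mu0)//.
      by rewrite ler_pXn2r ?nnegrE//; lra.
    by apply: left_factor; apply/andP; split; lra.
  by move: h; lra.
have Whi : omega < potential a1 a3 gamma t.
  have := double_rootE gamma t; rewrite subrr expr0n/= mul0r sub0r.
  have : 0 <= (gamma0 - gamma) / 2 * t ^+ 2.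
    by rewrite mulr_ge0 ?sqr_ge0// divr_ge0// subr_ge0 ltW.
  by lra.
have lor : 0 <= t - r <= t - r by rewrite lexx andbT; lra.
have [||z /andP[rz zt] Wz] := @potential_IVT _ a1 a3 gamma omega (t - r) t.
- by lra.
- by rewrite (ltW Whi) (ltW (Wlo _ lor)).
exists z.
have {}rz : t - r < z.
  by rewrite lt_neqAle rz andbT; apply/eqP => zE; have := Wlo _ lor;
    rewrite zE Wz ltxx.
have {}zt : z < t.
  by rewrite lt_neqAle zt andbT; apply/eqP => zE; move: Whi; rewrite -zE Wz ltxx.
have z0 : 0 < z by lra.
split => //; first by rewrite ltr_norml; lra.
apply: admissibleP => //.
  (* With [y = t - z <= r], [2 A + 3 B y] is the sum of [A + 2 B y] and [A + B y]; strictness comes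
     from [gamma < gamma0]. *)
  rewrite reduced_gamma0 ltr_wpDl//; last by rewrite mulr_gt0// subr_gt0.
  rewrite mulr_ge0 ?subr_ge0 ?(ltW zt)//.
  have : 0 <= A + B * (2 * (t - z)).
    by apply: BrA; apply/andP; split; lra.
  have : 0 <= A + B * (t - z).
    by apply: BrA; apply/andP; split; lra.
  by lra.
move=> s /andP[s0 sz]; have [sr|rs] := leP s (t - r).
  by rewrite Wz subr_gt0 Wlo// s0.
rewrite potential_gammaB ltr_wpDl//; last first.
  rewrite mulr_gt0 ?divr_gt0 ?subr_gt0//.
  by rewrite ltr_pXn2r ?nnegrE ?(ltW z0).
set x := t - s; set y := t - z.
have y0 : 0 <= y by rewrite /y; lra.
have yx : y <= x by rewrite /x /y; lra.
have xr : x <= r by rewrite /x; lra.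
clearbody x y.
rewrite [leRHS](_ : _ = (x - y) * (A * x + A * y + B * (x * x + x * y + y *
  y))); last by ring.
rewrite mulr_ge0 ?subr_ge0//.
have h1 : 0 <= x * (A + B * (x + y)).
  rewrite mulr_ge0//; first by lra.
  by apply: BrA; apply/andP; split; lra.
have h2 : 0 <= y * (A + B * y).
  by rewrite mulr_ge0//; apply: BrA; apply/andP; split; lra.
by move: h1 h2; lra.
Qed.

(** [K(t, w)] has a simple zero at [w = 0], which is a double one in [u], so [ustar = 0]; the
    numerator there is [2 t A > 0]. *)
Lemma left_blowup (D : R) : exists2 e, 0 < e &
  forall gamma z, `|gamma - gamma0| < e -> `|z - t| < e ->
    admissible a1 a3 gamma z -> D <= J a1 a3 (potential a1 a3 gamma z, gamma).
Proof.
have KE w : reduced a1 a3 gamma0 t w = t * w * (A + B * (t * w)).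
  by rewrite /reduced gamma0E a1E a3E; field.
have PE w : slope_numerator a1 a3 gamma0 t w =
    2 * t * A + w * (t * (2 * A + 3 * B * t)) + B * t ^+ 2 * w ^+ 2.
  by rewrite /slope_numerator gamma0E a1E a3E; field.
have q1 : 0 < t * (A + `|B| * t) by rewrite mulr_gt0// ltr_wpDr// mulr_ge0// ltW.
(* [K < kappa] forces [w L <= A], and the terms in [B], at least [- 4 |B| t w] inside the factor
   [t], then leave the numerator above [t A]. *)
pose L := 4 * `|B| * t + 1.
have L0 : 0 < L by rewrite ltr_wpDl// !mulr_ge0// ltW.
pose kappa := t * (A / L) * mu.
have kappa0 : 0 < kappa by rewrite !mulr_gt0// invr_gt0.
have p00 : 0 < t * A by rewrite mulr_gt0.
have us : 0 <= (0 : R) < 1 by rewrite lexx ltr01.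
have := @J_blowup _ a1 a3 gamma0 t 0 1 _ kappa _ t0 (expr1n _ 2) us q1 kappa0 p00.
case/(_ _ _ D).
- move=> u /sqr_in01 /andP[w0 w1]; rewrite KE subr0.
  rewrite [leRHS](_ : _ = t * u ^+ 2 * (A + `|B| * t)); last by ring.
  apply: ler_wpM2l; first by rewrite mulr_ge0 ?(ltW t0).
  rewrite lerD2l.
  have tw : 0 <= t * u ^+ 2 <= t by rewrite mulr_ge0 ?(ltW t0)//= ler_piMr// ltW.
  rewrite (le_trans (ler_norm _))// normrM ler_wpM2l// ger0_norm; by case/andP: tw.
- move=> u /sqr_in01; move: (u ^+ 2) => w /andP[w0 w1]; rewrite KE PE mul1r => Kk.
  have muw : mu <= A + B * (t * w).
    by apply: left_factor; rewrite mulr_ge0 ?(ltW t0)//= ler_piMr// ltW.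
  have wL : w * L <= A.
    rewrite -ler_pdivlMr// -(ler_pM2l t0) -(ler_pM2r mu0) (le_trans _ (ltW Kk))//.
    by rewrite ler_wpM2l// mulr_ge0// ltW.
  have wB : - (w * (4 * `|B| * t)) <= w * (3 * B * t) + B * t * w ^+ 2.
    rewrite [leRHS](_ : _ = w * t * (B * (3 + w))); last by ring.
    rewrite [leLHS](_ : _ = w * t * - (4 * `|B|)); last by ring.
    apply: ler_wpM2l; first by rewrite mulr_ge0// ltW.
    have := ler_norm (- B); rewrite normrN; have := ler_norm B; nra.
  rewrite [leRHS](_ : _ = t * (2 * A + w * (2 * A) + (w * (3 * B * t) + B * t *
    w ^+ 2))); last by ring.
  rewrite ler_pM2l//; move: wL; rewrite /L => wL.
  have wA : 0 <= w * (2 * A) by rewrite mulr_ge0// mulr_ge0// ltW.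
  by lra.
move=> e e0 He; exists e => // gamma z ge ze adm.
by rewrite -[leRHS]mul1r; apply: He.
Qed.

End left.

Section right.
Variable c : R.
Hypotheses (B0 : 0 < B) (tc : t < c) (AE : A = B * (c - t)).

Let ct : 0 < c - t. Proof. by rewrite subr_gt0. Qed.

Let hE s : (t - s) ^+ 2 * (A + B * (t - s)) = B * (s - t) ^+ 2 * (c - s).
Proof. by rewrite AE; ring. Qed.

(** Raising [omega] and [gamma] makes [h] positive on all of [[0, c]], where it was nonnegative, so
    the first root lies beyond [c]; there [W] is increasing and reaches [omega] before [c + r]. *)
Lemma right_solve (e : R) : 0 < e -> exists2 d, 0 < d &
  forall omega gamma, omega0 < omega < omega0 + d -> gamma0 < gamma < gamma0 + d ->
  exists z, [/\ `|z - c| < e, admissible a1 a3 gamma z &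
    potential a1 a3 gamma z = omega].
Proof.
move=> e0; pose r := e / 2; have r0 : 0 < r by rewrite divr_gt0.
have cr0 : 0 < c + r by rewrite addr_gt0// (lt_trans t0).
(* The slope [W'(c)] at [gamma0]; the bound [E / (c + r)] on [gamma - gamma0] keeps the difference
   quotients of [W] on [[c, c + r]] positive. *)
pose E := B * (c - t) ^+ 2.
have E0 : 0 < E by rewrite mulr_gt0// exprn_gt0.
have eta0 : 0 < E * r by rewrite mulr_gt0.
have [d d0 close] := potential_close a1 a3 omega0 gamma0 (c + r) eta0.
exists (Num.min d (E / (c + r))); first by rewrite lt_min d0 divr_gt0.
move=> omega gamma /andP[w1 w2] /andP[ga1 ga2].
have [wd gad] : omega < omega0 + d /\ gamma < gamma0 + d.
  have md : Num.min d (E / (c + r)) <= d by rewrite ge_min lexx.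
  by split; lra.
have gaE : (gamma - gamma0) * (c + r) < E.
  rewrite -ltr_pdivlMr// ltrBlDl (lt_le_trans ga2)// lerD2l ge_min lexx orbT//.
have nod : `|omega - omega0| < d by rewrite ltr_norml; lra.
have ngd : `|gamma - gamma0| < d by rewrite ltr_norml; lra.
have Wlo s : 0 <= s <= c -> potential a1 a3 gamma s < omega.
  move=> /andP[s0 sc]; have := double_rootE gamma s; rewrite hE.
  have : 0 <= B * (s - t) ^+ 2 * (c - s).
    by apply: mulr_ge0; [apply: mulr_ge0;
      [exact: ltW|exact: sqr_ge0]|rewrite subr_ge0].
  have : 0 <= (gamma - gamma0) / 2 * s ^+ 2.
    by rewrite mulr_ge0 ?sqr_ge0// divr_ge0// subr_ge0 ltW.
  by lra.
have quot z s : c <= s -> s <= z -> z <= c + r ->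
    (z - s) * (E - (gamma - gamma0) * (c + r)) <=
    potential a1 a3 gamma z - potential a1 a3 gamma s.
  move=> cs sz zr; rewrite potential_gammaB !hE.
  set x := s - c; set y := z - c.
  have x0 : 0 <= x by rewrite /x; lra.
  have y0 : 0 <= y by rewrite /y; lra.
  rewrite [leRHS](_ : _ = (z - s) * (E + B * (x * x + x * y + y * y +
     2 * (c - t) * (x + y)) - (gamma - gamma0) / 2 * (z + s))); last first.
    by rewrite /x /y /E; ring.
  rewrite ler_wpM2l ?subr_ge0//.
  have : (gamma - gamma0) / 2 * (z + s) <= (gamma - gamma0) / 2 * (2 * (c + r)).
    by rewrite ler_wpM2l; lra.
  have : 0 <= B * (x * x + x * y + y * y + 2 * (c - t) * (x + y)).
    move: (c - t) ct x y x0 y0 => k k0 x y x0 y0.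
    by rewrite !(addr_ge0, mulr_ge0) ?(ltW B0) ?(ltW k0).
  by lra.
have c0 : 0 <= c by rewrite ltW// (lt_trans t0).
have Whi : omega < potential a1 a3 gamma (c + r).
  have cr : 0 <= c + r <= c + r by rewrite lexx ltW.
  have := close _ _ _ nod ngd cr; rewrite (double_rootE gamma0) hE.
  rewrite subrr !mul0r subr0 ltr_norml => /andP[_].
  have : E * r <= B * (c + r - t) ^+ 2 * r.
    apply: ler_wpM2r; first exact: ltW.
    apply: ler_wpM2l; first exact: ltW.
    have h0 : 0 <= c - t by exact: ltW.
    have h1 : c - t <= c + r - t by rewrite lerD2r lerDl ltW.
    by rewrite ler_pXn2r ?nnegrE ?(le_trans h0 h1).
  by lra.
have cc : 0 <= c <= c by rewrite lexx c0.
have [||z /andP[cz zr] Wz] := @potential_IVT _ a1 a3 gamma omega c (c + r).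
- by lra.
- by rewrite (ltW Whi) (ltW (Wlo _ cc)).
exists z; split => //; first by rewrite ltr_norml /r in zr *; lra.
have z0 : 0 < z := lt_le_trans (lt_trans t0 tc) cz.
apply: admissibleP => //.
  rewrite reduced_gamma0 AE.
  set y := z - c; have y0 : 0 <= y by rewrite /y; lra.
  rewrite [ltRHS](_ : _ = E + B * (4 * (c - t) * y + 3 * y ^+ 2) - (gamma -
    gamma0) * z); last first.
    by rewrite /y /E; ring.
  have : (gamma - gamma0) * z <= (gamma - gamma0) * (c + r).
    by rewrite ler_wpM2l// subr_ge0 ltW.
  have : 0 <= B * (4 * (c - t) * y + 3 * y ^+ 2).
    move: (c - t) ct y y0 => k k0 y y0.
    by rewrite expr2 !(addr_ge0, mulr_ge0) ?(ltW B0) ?(ltW k0).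
  by lra.
move=> s /andP[s0 sz]; have [sc|cs] := leP s c.
  by rewrite Wz subr_gt0 Wlo// s0.
apply: lt_le_trans (quot z s (ltW cs) (ltW sz) zr).
by rewrite mulr_gt0 ?subr_gt0.
Qed.

(** [K(c, w)] vanishes where [c (1 - w)] is the double root [t], so [ustar^2 = (c - t) / c]; the
    numerator there is [- B c (c - t)], hence [b = -1]. *)
Lemma right_blowup (D : R) : exists2 e, 0 < e &
  forall gamma z, `|gamma - gamma0| < e -> `|z - c| < e ->
    admissible a1 a3 gamma z -> J a1 a3 (potential a1 a3 gamma z, gamma) <= D.
Proof.
have c0 : 0 < c := lt_trans t0 tc.
have KE w : reduced a1 a3 gamma0 c w = B * (c * w - (c - t)) ^+ 2.
  by rewrite /reduced gamma0E a1E a3E AE; field.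
have PE w : slope_numerator a1 a3 gamma0 c w = - (B * (c * (c - t) -
    (c + 2 * t) * (c * w - (c - t)) - (c * w - (c - t)) ^+ 2)).
  by rewrite /slope_numerator gamma0E a1E a3E AE; field.
pose us := Num.sqrt ((c - t) / c).
have us2 : us ^+ 2 = (c - t) / c by rewrite sqr_sqrtr// divr_ge0// ltW.
have us0 : 0 <= us by exact: sqrtr_ge0.
have us1 : us < 1.
  by rewrite -[ltRHS](@sqrtr1 R) ltr_sqrt// ltr_pdivrMr// mul1r ltrBlDr ltrDl.
have us01 : 0 <= us < 1 by rewrite us0.
have C0 : 0 < 4 * B * c ^+ 2 by rewrite !mulr_gt0// exprn_gt0.
(* With [y = c w - (c - t)], [K < B d^2] means [|y| < d]; since [c + 2 t < 3 c], the corrections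
   [(c + 2 t) y + y^2] then use up at most half of [c (c - t)]. *)
pose d := (c - t) / 8.
have d0 : 0 < d by rewrite divr_gt0.
have kappa0 : 0 < B * d ^+ 2 by rewrite mulr_gt0// exprn_gt0.
have p00 : 0 < B * (c * (c - t) / 2) by rewrite !mulr_gt0// invr_gt0.
have bb : (- 1) ^+ 2 = 1 :> R by rewrite sqrrN expr1n.
have := @J_blowup _ a1 a3 gamma0 c us (-1) _ _ _ c0 bb us01 C0 kappa0 p00.
case/(_ _ _ (- D)).
- move=> u /andP[u0 u1]; rewrite KE.
  have -> : c - t = c * us ^+ 2 by rewrite us2; field; rewrite gt_eqF.
  rewrite [leLHS](_ : _ = (B * c ^+ 2) * (u - us) ^+ 2 * (u + us) ^+ 2);
    last by ring.
  rewrite [leRHS](_ : _ = (B * c ^+ 2) * (u - us) ^+ 2 * 2 ^+ 2); last by ring.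
  apply: ler_wpM2l; last by rewrite ler_pXn2r ?nnegrE//; lra.
  by rewrite !(mulr_ge0 _ (sqr_ge0 _))// ltW.
- move=> u _; rewrite KE PE; move: (c * u ^+ 2 - (c - t)) => y.
  rewrite ltr_pM2l// => yd.
  have {}yd : `|y| < d.
    by rewrite -(@ltr_pXn2r _ 2) ?nnegrE ?(ltW d0)// real_normK ?num_real.
  rewrite mulN1r opprK ler_pM2l//.
  move: yd; rewrite ltr_norml /d => /andP[y1 y2].
  have h1 : (c + 2 * t) * y <= (c + 2 * t) * ((c - t) / 8).
    apply: ler_wpM2l (ltW y2).
    by rewrite addr_ge0 ?mulr_ge0 ?(ltW c0) ?(ltW t0).
  have h2 : y ^+ 2 <= ((c - t) / 8) ^+ 2.
    rewrite -(real_normK (num_real y)) ler_pXn2r ?nnegrE ?divr_ge0 ?(ltW ct)//.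
    by rewrite ler_norml; lra.
  by nra.
move=> e e0 He; exists e => // gamma z ge ze adm.
by have := He _ _ ge ze adm; lra.
Qed.

End right.

(* Here the simple root [c] precedes the double root [t]. *)
Lemma crossing_R_ex : A < 0 -> 0 < B ->
  exists2 d, 0 < d & forall omega gamma,
    `|omega - omega0| < d -> `|gamma - gamma0| < d ->
    R_ex a1 a3 (omega, gamma).
Proof.
move=> A0 B0; pose c := t + A / B.
have c0 : 0 < c by rewrite /c -(pmulr_rgt0 _ B0) mulrDr mulrCA divff ?gt_eqF//
  mulr1 addrC.
have AE : A = B * (c - t) by rewrite /c; field; rewrite gt_eqF.
have ct : c < t by rewrite /c gtrDl pmulr_llt0 ?invr_gt0.
have adm : admissible a1 a3 gamma0 c.
  split => // w /andP[w0 w1].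
  (* Without the simple root there remains [B (t - s)^2] at [s = c (1 - w)], and [s <= c < t]. *)
  have -> : reduced a1 a3 gamma0 c w = B * (t - c + c * w) ^+ 2.
    by rewrite /reduced gamma0E a1E a3E AE; field.
  by rewrite mulr_gt0// exprn_gt0// ltr_wpDr ?subr_gt0// mulr_ge0// ltW.
have := R_ex_open adm.
suff -> : potential a1 a3 gamma0 c = omega0 by [].
apply/esym/eqP; rewrite -subr_eq0 double_rootE AE; apply/eqP; ring.
Qed.

(* A profile would reach the value [t], with zero slope by [profile_energy],
   and [t] is an equilibrium. *)
Lemma double_root_no_profile : (forall s, 0 < s < t -> 0 < A + B * (t - s)) ->
  ~ R_ex a1 a3 (omega0, gamma0).
Proof.
move=> hpos [_ [phi /= prof]]; have [x0 phim] := profile_max prof.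
have tphi : t <= phi x0.
  rewrite leNgt; apply/negP => phit.
  have := profile_energy prof x0; rewrite (profile_max_slope prof phim).
  rewrite double_rootE subrr !mul0r subr0 expr0n/= => /esym/eqP.
  have p0 := profile_gt0 prof x0.
  by rewrite gt_eqF// !mulr_gt0// ?exprn_gt0 ?subr_gt0// hpos// p0.
have [|x phix] := profile_surj prof (x0 := x0) (s := t); first by rewrite t0.
have := profile_energy prof x; rewrite phix double_rootE !subrr !mul0r subr0.
rewrite expr0n/= mul0r mulr0 => /eqP; rewrite sqrf_eq0 => /eqP p0.
apply: (profile_no_equilibrium prof p0); rewrite phix profile_rhsE ?(ltW t0)//.
by rewrite omega0E gamma0E a1E a3E; field.
Qed.

End double_root.

(** * Joint limits of [J] and the sign of [A] *)

Lemma near_pair (R : realType) (p : R * R) (P : R * R -> Prop) (d : R) :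
  0 < d -> (forall q, `|q.1 - p.1| < d -> `|q.2 - p.2| < d -> P q) ->
  \forall q \near p, P q.
Proof.
move=> d0 dP; apply/nbhs_ballP; exists d => //= q [q1 q2].
by apply: dP; rewrite distrC.
Qed.

(** Close to [p] the region [Q] lies in [R_ex], so [p] is a limit point of the intersection as soon
    as it is one of [Q]. *)
Lemma J_limitP (R : realType) (a1 a3 : R) (Q : set (R * R)) (p : R * R)
    (F : set_system R) :
  (forall d, 0 < d -> exists q, [/\ Q q, `|q.1 - p.1| < d & `|q.2 - p.2| < d]) ->
  (exists2 d, 0 < d & forall q, `|q.1 - p.1| < d -> `|q.2 - p.2| < d ->
    Q q -> R_ex a1 a3 q) ->
  (J a1 a3 q @[q --> within (R_ex a1 a3 `&` Q) (nbhs p)] --> F) ->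
  J_limit a1 a3 Q p F.
Proof.
move=> Qp [d d0 dQ] JF; split => // V /nbhs_ballP[e /= e0 eV].
have [|q [Qq q1 q2]] := Qp (Num.min d e); first by rewrite lt_min d0.
move: q1 q2; rewrite !lt_min => /andP[q1 q1e] /andP[q2 q2e].
exists q; split; first by split => //; exact: dQ.
by apply: eV; split; rewrite /ball/= distrC.
Qed.

Section double_root_limits.
Context (R : realType) (a1 a3 omega0 gamma0 t A B : R).
Hypotheses (t0 : 0 < t) (a1E : a1 = 3 * t * A + 9 / 2 * B * t ^+ 2)
  (a3E : a3 = 5 / 2 * B) (gamma0E : gamma0 = 2 * A + 6 * B * t)
  (omega0E : omega0 = t ^+ 2 * (A + B * t)) (omega0_gt0 : 0 < omega0) (A0 : 0 < A).

Lemma J_limit_left :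
  J_limit a1 a3 [set q | q.1 < omega0 /\ q.2 < gamma0] (omega0, gamma0)
    (pinfty_nbhs R).
Proof.
have near_left e : 0 < e -> exists2 d, 0 < d & forall q : R * R,
    `|q.1 - omega0| < d -> `|q.2 - gamma0| < d -> q.1 < omega0 /\ q.2 < gamma0 ->
    exists z, [/\ `|z - t| < e, admissible a1 a3 q.2 z & potential a1 a3 q.2 z
      = q.1].
  move=> e0; have [d d0 solve] :=
    left_solve t0 a1E a3E gamma0E omega0E omega0_gt0 A0 e0.
  exists d => // q; rewrite !ltr_norml => /andP[h1 _] /andP[h2 _] [h3 h4].
  by apply: solve; apply/andP; split => //; lra.
apply: J_limitP.
- move=> d d0; exists (omega0 - d / 2, gamma0 - d / 2) => /=.
  by split; [split| |]; rewrite ?ltr_norml; lra.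
- have [d d0 dz] := near_left 1 ltr01; exists d => // -[w g] q1 q2 Qq.
  by have [z [_ adm /= <-]] := dz _ q1 q2 Qq; exact: R_ex_admissible.
- apply/cvgryPge => D.
  have [e e0 blow] := left_blowup t0 a1E a3E gamma0E omega0E omega0_gt0 A0 D.
  have [d d0 dz] := near_left e e0.
  have de0 : 0 < Num.min d e by rewrite lt_min d0.
  apply: (near_pair de0) => -[w g] /=.
  rewrite !lt_min => /andP[q1 _] /andP[q2 q2e] [_ Qq].
  have [z [ze adm /= zw]] := dz (w, g) q1 q2 Qq.
  by rewrite -zw; apply: blow.
Qed.

Lemma J_limit_right (B0 : 0 < B) :
  J_limit a1 a3 [set q | omega0 < q.1 /\ gamma0 < q.2] (omega0, gamma0)
    (ninfty_nbhs R).
Proof.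
pose c := t + A / B.
have tc : t < c by rewrite /c ltrDl divr_gt0.
have AE : A = B * (c - t) by rewrite /c; field; rewrite gt_eqF.
have near_right e : 0 < e -> exists2 d, 0 < d & forall q : R * R,
    `|q.1 - omega0| < d -> `|q.2 - gamma0| < d -> omega0 < q.1 /\ gamma0 < q.2 ->
    exists z, [/\ `|z - c| < e, admissible a1 a3 q.2 z & potential a1 a3 q.2 z
      = q.1].
  move=> e0; have [d d0 solve] :=
    right_solve t0 a1E a3E gamma0E omega0E B0 tc AE e0.
  exists d => // q; rewrite !ltr_norml => /andP[_ h1] /andP[_ h2] [h3 h4].
  by apply: solve; apply/andP; split => //; lra.
apply: J_limitP.
- move=> d d0; exists (omega0 + d / 2, gamma0 + d / 2) => /=.
  by split; [split| |]; rewrite ?ltr_norml; lra.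
- have [d d0 dz] := near_right 1 ltr01; exists d => // -[w g] q1 q2 Qq.
  by have [z [_ adm /= <-]] := dz _ q1 q2 Qq; exact: R_ex_admissible.
- apply/cvgrNyPle => D.
  have [e e0 blow] := right_blowup t0 a1E a3E gamma0E B0 tc AE D.
  have [d d0 dz] := near_right e e0.
  have de0 : 0 < Num.min d e by rewrite lt_min d0.
  apply: (near_pair de0) => -[w g] /=.
  rewrite !lt_min => /andP[q1 _] /andP[q2 q2e] [_ Qq].
  have [z [ze adm /= zw]] := dz (w, g) q1 q2 Qq.
  by rewrite -zw; apply: blow.
Qed.

End double_root_limits.

(** The equation on [t] is [A = 0] for [a1 = a3 = 1]: the double and the simple root coincide. *)
Lemma cusp_unique (R : realType) (t : R) : 0 < t -> 5 = 9 * t ^+ 2 ->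
  t = Num.sqrt 5 / 3.
Proof.
move=> t0 t2; have -> : Num.sqrt 5 = 3 * t :> R.
  rewrite t2 (_ : 9 * t ^+ 2 = (3 * t) ^+ 2); last by ring.
  by rewrite sqrtr_sqr gtr0_norm// mulr_gt0.
by field.
Qed.

Theorem proposition4p1 (R : realType) (a1 a3 : R)
  (signs : [\/ a1 = 1 /\ a3 = 1, a1 = 1 /\ a3 = -1 | a1 = -1 /\ a3 = -1])
  (omega0 gamma0 t : R)
  (boundary : Gamma_no a1 a3 (omega0, gamma0))
  (t_gt0 : 0 < t)
  (omega0E : omega0 = a1 * (t / 3) - a3 * (1 / 5) * t ^+ 3)
  (gamma0E : gamma0 = a1 * (2 / (3 * t)) + a3 * (6 / 5) * t)
  (not_cusp : a1 = 1 -> a3 = 1 ->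
    (omega0, gamma0) <> (2 * Num.sqrt 5 / 27, 4 * Num.sqrt 5 / 5)) :
  [/\ ~ R_ex a1 a3 (omega0, gamma0),
      J_limit a1 a3 [set q | q.1 < omega0 /\ q.2 < gamma0] (omega0, gamma0)
        (pinfty_nbhs R) &
      a1 = 1 -> a3 = 1 ->
      J_limit a1 a3 [set q | omega0 < q.1 /\ gamma0 < q.2] (omega0, gamma0)
        (ninfty_nbhs R)].
Proof.
have [omega0_gt0 [clos _]] := boundary; rewrite /parameter_domain/= in omega0_gt0.
have tN0 : t != 0 by rewrite gt_eqF.
pose A := a1 / (3 * t) - 3 / 5 * a3 * t; pose B := 2 / 5 * a3.
have a1E : a1 = 3 * t * A + 9 / 2 * B * t ^+ 2 by rewrite /A /B; field.
have a3E : a3 = 5 / 2 * B by rewrite /B; field.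
have gamma0E' : gamma0 = 2 * A + 6 * B * t by rewrite gamma0E /A /B; field.
have omega0E' : omega0 = t ^+ 2 * (A + B * t) by rewrite omega0E /A /B; field.
have q0 : 0 < A + B * t.
  by move: omega0_gt0; rewrite omega0E' pmulr_rgt0// exprn_gt0.
have A0 : 0 < A.
  have [B0|B0] := leP B 0.
    by apply: (lt_le_trans q0); rewrite gerDl mulr_le0_ge0// ltW.
  have [a1_1 a3_1] : a1 = 1 /\ a3 = 1.
    move: B0; rewrite /B; case: signs => -[-> ->]//;
      rewrite mulrN1 oppr_gt0 ltNge divr_ge0//.
  have [|A0|A0] := ltgtP 0 A => //.
    (* [A < 0]: a whole neighbourhood of the point would lie in [R_ex], against its membership in
       the closure of [R_no]. *)
    have [d d0 dR] := crossing_R_ex t_gt0 a1E a3E gamma0E' omega0E' omega0_gt0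
      A0 B0.
    have /clos[q [[_ nq] Rq]] : \forall q \near (omega0, gamma0), R_ex a1 a3 q.
      by apply: (near_pair d0) => -[w g]; exact: dR.
    by [].
  exfalso; apply: (not_cusp a1_1 a3_1).
  (* [15 t A = 5 - 9 t^2], so [A = 0] determines [t] and with it the excluded point. *)
  have t2 : 5 = 9 * t ^+ 2.
    move: A0; rewrite /A a1_1 a3_1 => /esym h.
    have : 15 * t * (1 / (3 * t) - 3 / 5 * 1 * t) = 0 by rewrite h mulr0.
    have -> : 15 * t * (1 / (3 * t) - 3 / 5 * 1 * t) = 5 - 9 * t ^+ 2 by field.
    by move/eqP; rewrite subr_eq0 => /eqP.
  have s5 : Num.sqrt 5 = 3 * t by rewrite {1}(cusp_unique t_gt0 t2); field.
  have t2' : t ^+ 2 = 5 / 9 by lra.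
  have e2 : 6 / 5 * t * (3 * t) = 2.
    by rewrite (_ : _ * _ = 18 / 5 * t ^+ 2); [rewrite t2'; field|ring].
  rewrite omega0E gamma0E a1_1 a3_1 s5; congr (_, _).
    by rewrite exprS t2'; field.
  by rewrite -[X in X / (3 * t)]e2; field.
split.
- apply: (double_root_no_profile t_gt0 a1E a3E gamma0E' omega0E') => s /andP[s0 st].
  have [B0|B0] := leP 0 B; first by rewrite ltr_wpDr// mulr_ge0// subr_ge0 ltW.
  apply: lt_le_trans q0 _; rewrite lerD2l ler_nM2l//; lra.
- exact: (J_limit_left t_gt0 a1E a3E).
- move=> _ a3_1; apply: (J_limit_right t_gt0 a1E a3E) => //.
  by rewrite /B a3_1 mulr1 divr_gt0.
Qed.
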